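(* Let $k$ be a field. Let $F$ be a contravariant functor from the category of $k$-schemes to the category of sets. Suppose that for every smooth integral $k$-variety $U$ the map $F(U) \to F(\mathbb{P}^1_U)$ induced by the projection $\mathbb{P}^1_U \to U$ is an isomorphism (bijection). Let $X$ be a proper, integral, generically smooth $k$-variety. If $X$ is almost $\mathrm{R}$-trivial, then there exists a nonempty smooth open subset $U \subset X$ such that $$\mathrm{Im}\big(F(X) \to F(U)\big) = \mathrm{Im}\big(F(k) \to F(U)\big),$$ where the map $F(k) \to F(U)$ is induced by the structure morphism $U \to \mathrm{Spec}(k)$ and $F(X)\to F(U)$ by the inclusion.
   Context: $F(k)$ means $F(\mathrm{Spec}(k))$. For a field $L$ and an $L$-variety $V$, two points $A,B\in V(L)$ are elementarily $\mathrm{R}$-linked if there exist an open subset $W\subset \mathbb{P}^1_L$ and an $L$-morphism $h: W\to V$ with $A,B\in h(W(L))$. Two points $A,B\in V(L)$ are $\mathrm{R}$-equivalent if there is a chain $A=A_1,\dots,A_n=B$ in $V(L)$ with $A_i$ and $A_{i+1}$ elementarily $\mathrm{R}$-linked for each $i$. The quotient of $V(L)$ by this equivalence relation is denoted $V(L)/\mathrm{R}$. For a field $L\supset k$ and a $k$-variety $X$, $X(L)/\mathrm{R}$ means $X_L(L)/\mathrm{R}$ computed over $L$, where $X_L=X\times_k L$. An integral $k$-variety $X$ is almost $\mathrm{R}$-trivial if there is a dense Zariski open subset $U\subset X$ such that for every field $L$ containing $k$ the image of $U(L)$ in $X(L)/\mathrm{R}$ has exactly one element. *)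

(* Defs.v *)
From HB Require Import structures.
From mathcomp Require Import all_boot all_algebra.
From mathcomp Require Import boolp.
From mathcomp Require Import ring.
From Stdlib Require Import Relation_Operators.

Set Implicit Arguments.
Unset Strict Implicit.
Unset Printing Implicit Defensive.
Import GRing.Theory.
Local Open Scope ring_scope.

(* Schemes are treated through their functors of points, following Demazure   *)
(* and Gabriel: a k-scheme is a functor from commutative k-algebras to sets   *)
(* which is a Zariski sheaf and is covered by affine open subfunctors.  By    *)
(* Yoneda, morphisms of k-schemes are natural transformations, V(L) is the    *)
(* value of V at L, and fibre products over k are computed pointwise.         *)

(* [comPzRingType] rather than [comNzRingType]: the zero ring is an algebra.  *)
Record kalg (k : fieldType) := KAlg {
  kalg_ring :> comPzRingType;
  kalg_str : {rmorphism k -> kalg_ring} }.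

Record khom (k : fieldType) (A B : kalg k) := KHom {
  khom_fun :> {rmorphism A -> B};
  khomP : forall c : k, khom_fun (kalg_str A c) = kalg_str B c }.

Lemma khom_ext (k : fieldType) (A B : kalg k) (f g : khom A B) :
  (forall a, f a = g a) -> f = g.
Proof.
case: f g => [f Hf] [g Hg] /= fg.
have E : f = g.
  case: f g fg {Hf Hg} => [f [[f1] [f2]]] [g [[g1] [g2]]] /= fg.
  have E : f = g by apply/funext.
  subst g; congr (GRing.RMorphism.Pack _); congr GRing.RMorphism.Class;
    by congr (_ _); apply: Prop_irrelevance.
by subst g; congr KHom; apply: Prop_irrelevance.
Qed.

Definition khom_id (k : fieldType) (A : kalg k) : khom A A :=
  @KHom k A A idfun (fun=> erefl).

Lemma khom_comp_subproof (k : fieldType) (A B C : kalg k)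
    (g : khom B C) (f : khom A B) (c : k) :
  (g \o f) (kalg_str A c) = kalg_str C c.
Proof. by rewrite /= !khomP. Qed.

Definition khom_comp (k : fieldType) (A B C : kalg k)
    (g : khom B C) (f : khom A B) : khom A C :=
  @KHom k A C (g \o f : {rmorphism _ -> _}) (khom_comp_subproof g f).

Definition base_alg (k : fieldType) : kalg k := @KAlg k k idfun.

Definition str_hom (k : fieldType) (A : kalg k) : khom (base_alg k) A :=
  @KHom k (base_alg k) A (kalg_str A) (fun=> erefl).

Definition field_alg (k K : fieldType) (j : {rmorphism k -> K}) : kalg k :=
  @KAlg k K j.

Definition restr_alg (k L : fieldType) (j : {rmorphism k -> L})
    (A : kalg L) : kalg k :=
  @KAlg k A (kalg_str A \o j : {rmorphism _ -> _}).

Definition restr_hom (k L : fieldType) (j : {rmorphism k -> L})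
    (A B : kalg L) (f : khom A B) : khom (restr_alg j A) (restr_alg j B) :=
  @KHom k (restr_alg j A) (restr_alg j B) f (fun c => khomP f (j c)).

Definition is_ideal (R : comPzRingType) (I : R -> Prop) : Prop :=
  I 0 /\ forall c a b, I a -> I b -> I (c * a + b).

Definition unit_ideal (R : comPzRingType) (E : R -> Prop) : Prop :=
  forall I : R -> Prop, is_ideal I -> (forall a, E a -> I a) -> I 1.

Definition im_set (A B : Type) (f : A -> B) (E : A -> Prop) (b : B) : Prop :=
  exists2 a, E a & b = f a.

(* rho exhibits S as the localization R[1/f].                                *)
Definition is_localization (k : fieldType) (R S : kalg k) (f : R)
    (rho : khom R S) : Prop :=
  [/\ exists u, u * rho f = 1,
      forall s, exists r n, s * rho f ^+ n = rho r
    & forall r, rho r = 0 -> exists n, f ^+ n * r = 0].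

Definition fin_gen (k : fieldType) (A : kalg k) : Prop :=
  exists s : seq A, forall P : A -> Prop,
    (forall c, P (kalg_str A c)) ->
    (forall a b, P a -> P b -> P (a + b)) ->
    (forall a b, P a -> P b -> P (a * b)) ->
    (forall a, a \in s -> P a) -> forall a, P a.

Record kfunctor (k : fieldType) := KFunctor {
  fobj :> kalg k -> Type;
  fmap : forall A B : kalg k, khom A B -> fobj A -> fobj B;
  fmap_id : forall A x, fmap (khom_id A) x = x;
  fmap_comp : forall A B C (g : khom B C) (f : khom A B) x,
    fmap (khom_comp g f) x = fmap g (fmap f x) }.

Arguments fmap {k} X {A B} f x : rename.

Record nat_trans (k : fieldType) (X Y : kfunctor k) := NatTrans {
  ntrans :> forall A : kalg k, X A -> Y A;
  ntransP : forall A B (f : khom A B) x,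
    ntrans (fmap X f x) = fmap Y f (ntrans x) }.

Arguments ntrans {k X Y} h {A} x : rename.

Definition nt_id (k : fieldType) (X : kfunctor k) : nat_trans X X :=
  @NatTrans k X X (fun _ x => x) (fun _ _ _ _ => erefl).

Lemma nt_comp_subproof (k : fieldType) (X Y Z : kfunctor k)
    (g : nat_trans Y Z) (f : nat_trans X Y) (A B : kalg k) (h : khom A B) x :
  ntrans g (ntrans f (fmap X h x)) = fmap Z h (ntrans g (ntrans f x)).
Proof. by rewrite !ntransP. Qed.

Definition nt_comp (k : fieldType) (X Y Z : kfunctor k)
    (g : nat_trans Y Z) (f : nat_trans X Y) : nat_trans X Z :=
  NatTrans (nt_comp_subproof g f).

(* R1 i is the localization R[1 / f i], and R2 i j is R[1 / (f i * f j)].     *)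
Definition zariski_sheaf (k : fieldType) (X : kfunctor k) : Prop :=
  forall (R : kalg k) (n : nat) (f : 'I_n -> R)
    (R1 : 'I_n -> kalg k) (rho : forall i, khom R (R1 i))
    (R2 : 'I_n -> 'I_n -> kalg k)
    (l : forall i j, khom (R1 i) (R2 i j))
    (r : forall i j, khom (R1 j) (R2 i j)),
  unit_ideal (fun a => exists i, a = f i) ->
  (forall i, is_localization (f i) (rho i)) ->
  (forall i j, is_localization (f i * f j) (khom_comp (l i j) (rho i))) ->
  (forall i j, khom_comp (l i j) (rho i) = khom_comp (r i j) (rho j)) ->
  forall x : forall i, X (R1 i),
  (forall i j, fmap X (l i j) (x i) = fmap X (r i j) (x j)) ->
  exists! y : X R, forall i, fmap X (rho i) y = x i.

(* V is an open subfunctor when its pullback along each Spec R -> X is the   *)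
(* complement of the closed subset V(E) for some E.                          *)
Definition open_cond (k : fieldType) (X : kfunctor k)
    (V : forall R : kalg k, X R -> Prop) : Prop :=
  forall (R : kalg k) (x : X R), exists E : R -> Prop,
  forall (S : kalg k) (phi : khom R S),
    V S (fmap X phi x) <-> unit_ideal (im_set phi E).

(* By the lemma below an open subset is automatically a subfunctor. *)
Record open_sub (k : fieldType) (X : kfunctor k) := OpenSub {
  open_mem :> forall R : kalg k, X R -> Prop;
  open_memP : open_cond open_mem }.

Arguments open_mem {k X} V {R} x : rename.

Lemma unit_ideal_im (R S : comPzRingType) (phi : {rmorphism R -> S}) E :
  unit_ideal E -> unit_ideal (im_set phi E).
Proof.
move=> uE I [I0 I1] HI; rewrite -(rmorph1 phi).
apply: (uE (fun a => I (phi a))).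
  split=> [|c a b Ia Ib]; first by rewrite rmorph0.
  by rewrite rmorphD rmorphM; apply: I1.
by move=> a Ea; apply: HI; exists a.
Qed.

Lemma im_set_id (A : Type) (f : A -> A) (E : A -> Prop) :
  f =1 id -> im_set f E = E.
Proof.
move=> f1; apply/funext => a; apply/propext; split.
  by case=> b Eb ->; rewrite f1.
by move=> Ea; exists a; rewrite ?f1.
Qed.

Lemma open_stable (k : fieldType) (X : kfunctor k) (V : open_sub X)
    (R S : kalg k) (phi : khom R S) (x : X R) :
  open_mem V x -> open_mem V (fmap X phi x).
Proof.
have [E HE] := open_memP V x.
rewrite -{1}(fmap_id x) => /HE; rewrite im_set_id // => uE.
by apply/HE; apply: unit_ideal_im.
Qed.

Definition open_subfunctor (k : fieldType) (X : kfunctor k)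
    (V : open_sub X) : kfunctor k.
Proof.
exists (fun R => {x : X R | open_mem V x})
       (fun R S phi x => exist _ (fmap X phi (sval x))
                                 (open_stable phi (svalP x))).
- by move=> A [x Vx]; apply: eq_exist => /=; rewrite fmap_id.
- by move=> A B C g f [x Vx]; apply: eq_exist => /=; rewrite fmap_comp.
Defined.

(* (A, a) represents V, i.e. a : Spec A -> X is an isomorphism onto V.       *)
Definition represents (k : fieldType) (X : kfunctor k) (V : open_sub X)
    (A : kalg k) (a : X A) : Prop :=
  open_mem V a /\
  forall (R : kalg k) (x : X R), open_mem V x ->
    exists! phi : khom A R, fmap X phi a = x.

Definition is_scheme (k : fieldType) (X : kfunctor k) : Prop :=
  zariski_sheaf X /\
  forall (K : fieldType) (j : {rmorphism k -> K}) (x : X (field_alg j)),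
    exists (V : open_sub X) (A : kalg k) (a : X A),
      represents V a /\ open_mem V x.

Record scheme (k : fieldType) := MkScheme {
  scheme_fun :> kfunctor k;
  schemeP : is_scheme scheme_fun }.

Definition Spec_fun (k : fieldType) (A : kalg k) : kfunctor k.
Proof.
exists (fun R => khom A R) (fun R S phi x => khom_comp phi x).
- by move=> R x; apply: khom_ext.
- by move=> R S T g f x; apply: khom_ext.
Defined.

Definition prod_fun (k : fieldType) (X Y : kfunctor k) : kfunctor k.
Proof.
exists (fun R => (X R * Y R)%type)
       (fun R S phi x => (fmap X phi x.1, fmap Y phi x.2)).
- by move=> R [x y]; rewrite !fmap_id.
- by move=> R S T g f [x y]; rewrite !fmap_comp.
Defined.

Definition proj1_fun (k : fieldType) (X Y : kfunctor k) :
    nat_trans (prod_fun X Y) X :=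
  @NatTrans k (prod_fun X Y) X (fun R x => x.1) (fun _ _ _ _ => erefl).

Definition proj2_fun (k : fieldType) (X Y : kfunctor k) :
    nat_trans (prod_fun X Y) Y :=
  @NatTrans k (prod_fun X Y) Y (fun R x => x.2) (fun _ _ _ _ => erefl).

Definition base_change (k L : fieldType) (j : {rmorphism k -> L})
    (X : kfunctor k) : kfunctor L.
Proof.
exists (fun R => X (restr_alg j R)) (fun R S phi x => fmap X (restr_hom j phi) x).
- move=> R x; rewrite -[RHS]fmap_id; congr (fmap X _ x); exact: khom_ext.
- move=> R S T g f x; rewrite -fmap_comp; congr (fmap X _ x); exact: khom_ext.
Defined.

Definition is_submod2 (R : comPzRingType) (N : R -> R -> Prop) : Prop :=
  N 0 0 /\ forall c a b a' b', N a b -> N a' b' -> N (c * a + a') (c * b + b').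

(* These N are exactly the rank one direct summands of R^2: the coordinates  *)
(* of the vectors of N generate the unit ideal, and where the coordinate a   *)
(* of (a, b) in N is invertible, the determinant condition forces N to be    *)
(* free on (1, b / a); symmetrically where b is invertible.                  *)
Definition is_line (R : comPzRingType) (N : R -> R -> Prop) : Prop :=
  [/\ is_submod2 N,
      forall a b c d, N a b -> N c d -> a * d - b * c = 0
    & unit_ideal (fun a => exists b, N a b \/ N b a)].

(* the S-submodule of S^2 spanned by the image of N *)
Definition span_im (R S : comPzRingType) (phi : R -> S) (N : R -> R -> Prop)
    (x y : S) : Prop :=
  forall M, is_submod2 M -> (forall a b, N a b -> M (phi a) (phi b)) -> M x y.

Lemma span_im_submod (R S : comPzRingType) (phi : R -> S) N :
  is_submod2 (span_im phi N).
Proof.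
split=> [M [M0 _] _ //|c a b a' b' Hab Hab' M HM HN].
by case: (HM) => _; apply; [apply: Hab|apply: Hab'].
Qed.

Lemma span_im_gen (R S : comPzRingType) (phi : R -> S) N a b :
  N a b -> span_im phi N (phi a) (phi b).
Proof. by move=> Nab M _; apply. Qed.

Lemma span_im_line (R S : comPzRingType) (phi : {rmorphism R -> S}) N :
  is_line N -> is_line (span_im phi N).
Proof.
case=> [[N0 N1] Nd Nu]; split.
- exact: span_im_submod.
- move=> a b c d Hab Hcd.
  apply: (Hcd (fun x y => a * y - b * x = 0)) => [|x y Nxy].
    split=> [|e x y x' y' E E']; first by rewrite !mulr0 subrr.
    rewrite !mulrDr opprD addrACA E' addr0.
    by rewrite !(mulrCA _ e) -mulrBr E mulr0.
  apply: (Hab (fun p q => p * phi y - q * phi x = 0)) => [|p q Npq].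
    split=> [|e p q p' q' E E']; first by rewrite !mul0r subrr.
    rewrite !mulrDl opprD addrACA E' addr0.
    by rewrite -!mulrA -mulrBr E mulr0.
  by rewrite -!rmorphM -rmorphB (Nd _ _ _ _ Npq Nxy) rmorph0.
- move=> I II HI; have := (unit_ideal_im (phi:=phi) Nu II); apply => _ [a [b Hab] ->].
  by apply: HI; exists (phi b); case: Hab => H; [left|right]; apply: span_im_gen.
Qed.

Lemma span_im_id (R : comPzRingType) (phi : R -> R) N :
  phi =1 id -> is_submod2 N -> span_im phi N = N.
Proof.
move=> f1 HN; apply/funext => x; apply/funext => y; apply/propext; split.
  by move/(_ N HN); apply=> a b; rewrite !f1.
by move=> Nxy M _ HM; have := HM _ _ Nxy; rewrite !f1.
Qed.

Lemma span_im_comp (R S T : comPzRingType) (f : R -> S)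
    (g : {rmorphism S -> T}) (N : R -> R -> Prop) :
  span_im (g \o f) N = span_im g (span_im f N).
Proof.
apply/funext => x; apply/funext => y; apply/propext; split.
  move/(_ _ (span_im_submod _ _)); apply=> a b Nab.
  by do 2!apply: span_im_gen.
move/(_ _ (span_im_submod _ _)); apply=> a b.
have [S0 S1] := span_im_submod (g \o f) N.
move/(_ (fun x y => span_im (g \o f) N (g x) (g y))); apply.
  split=> [|c p q p' q' H H']; first by rewrite rmorph0.
  by rewrite !rmorphD !rmorphM; apply: S1.
by move=> c d Ncd; apply: (@span_im_gen _ _ (g \o f)).
Qed.

Definition P1_fun (k : fieldType) : kfunctor k.
Proof.
exists (fun R : kalg k => {N : R -> R -> Prop | is_line N})
       (fun (R S : kalg k) (phi : khom R S) N =>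
          exist _ (span_im phi (sval N))
                  (span_im_line phi (svalP N))).
- move=> R [N HN]; apply: eq_exist => /=; apply: span_im_id => //.
  by case: HN.
- move=> R S T g f [N HN]; apply: eq_exist => /=; exact: span_im_comp.
Defined.

Section Localization.
Variable k : fieldType.

Lemma ideal_exp (R : comPzRingType) (I : R -> Prop) :
  is_ideal I -> is_ideal (fun a => exists n, I (a ^+ n)).
Proof.
case=> I0 I1.
have Im c a : I a -> I (c * a) by move=> Ia; rewrite -[c * a]addr0; apply: I1.
have Ia a b : I a -> I b -> I (a + b).
  by move=> Ia Ib; rewrite -[a]mul1r; apply: I1.
split=> [|c a b [n In] [m Im']]; first by exists 1%N; rewrite expr1.
exists (n + m)%N; rewrite exprDn; apply: (big_ind I) => // i _.
rewrite -mulr_natl; apply: (Im); case: (leqP m i) => h.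
  by rewrite -(subnK h) exprD mulrA; apply: Im.
rewrite mulrC; apply: (Im).
have h2 : (n <= n + m - i)%N by rewrite -addnBA ?leq_addr // ltnW.
by rewrite -(subnK h2) exprD [_ ^+ n]exprMn; do 2!apply: (Im).
Qed.

Lemma unit_ideal_exp (R : comPzRingType) (E I : R -> Prop) :
  unit_ideal E -> is_ideal I -> (forall a, E a -> exists n, I (a ^+ n)) -> I 1.
Proof.
by move=> uE II H; have [n] := uE _ (ideal_exp II) H; rewrite expr1n.
Qed.

Lemma fin_bound n (P : 'I_n -> nat -> Prop) :
  (forall i m p, (m <= p)%N -> P i m -> P i p) ->
  (forall i, exists m, P i m) -> exists m, forall i, P i m.
Proof.
move=> Pm /choice [g Hg]; exists (\max_i g i)%N => i.
by apply: Pm (Hg i); apply: leq_bigmax.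
Qed.

Lemma loc_trans (R R1 R2 : kalg k) (f g : R) (rho : khom R R1)
    (l : khom R1 R2) :
  is_localization g rho -> is_localization (f * g) (khom_comp l rho) ->
  is_localization (rho f) l.
Proof.
case=> [[u u1] s1 z1] [[v v1] s2 z2].
have un p : u ^+ p * rho g ^+ p = 1 by rewrite -exprMn u1 expr1n.
split.
- exists (v * l (rho g)); move: v1 => /=; rewrite !rmorphM /= => <-.
  by rewrite -mulrA (mulrC (l (rho g))).
- move=> s; have [r [n]] := s2 s; rewrite /= => E.
  exists (rho r * u ^+ n), n; rewrite rmorphM /= -E !rmorphM exprMn rmorphXn.
  have := congr1 l (un n); rewrite rmorphM rmorph1 !rmorphXn => un'.
  by rewrite -!mulrA (mulrC (l (rho g) ^+ n)) un' mulr1.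
- move=> x lx; have [r [n E]] := s1 x.
  have /z2 [m] : khom_comp l rho r = 0.
    by rewrite /= -E rmorphM lx mul0r.
  rewrite exprMn.
  move=> /(congr1 rho); rewrite !rmorphM /= -E rmorph0 !rmorphXn => E2.
  exists m; have := congr1 (fun t => u ^+ (m + n) * t) E2; rewrite mulr0 => <-.
  rewrite -mulrA (mulrCA (rho g ^+ m)) (mulrC x) (mulrCA _ (rho f ^+ m)).
  congr (_ * _).
  by rewrite !mulrA -(mulrA _ (rho g ^+ m)) -exprD un mul1r.
Qed.

End Localization.

Section Gluing.
Variables (k : fieldType) (R : kalg k) (n : nat) (f : 'I_n -> R).
Variables (R1 : 'I_n -> kalg k) (rho : forall i, khom R (R1 i)).
Variables (R2 : 'I_n -> 'I_n -> kalg k).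
Variables (l : forall i j, khom (R1 i) (R2 i j)).
Variables (r : forall i j, khom (R1 j) (R2 i j)).
Hypothesis uf : unit_ideal (fun a => exists i, a = f i).
Hypothesis loc1 : forall i, is_localization (f i) (rho i).
Hypothesis loc2 : forall i j, is_localization (f i * f j) (khom_comp (l i j) (rho i)).
Hypothesis lr : forall i j, khom_comp (l i j) (rho i) = khom_comp (r i j) (rho j).

Lemma lrE i j a : l i j (rho i a) = r i j (rho j a).
Proof. by have := congr1 (fun h : khom _ _ => h a) (lr i j). Qed.

Lemma loc_r i j : is_localization (rho j (f i)) (r i j).
Proof. by apply: loc_trans (loc1 j) _; rewrite -lr. Qed.

Lemma glue_cover (I : R -> Prop) :
  is_ideal I -> (forall i, exists m, I (f i ^+ m)) -> I 1.
Proof. by move=> II H; apply: unit_ideal_exp uf II _ => _ [i ->]. Qed.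

Lemma glue_sep a b : (forall i, rho i a = rho i b) -> a = b.
Proof.
move=> E; suff : 1 * (a - b) = 0 by rewrite mul1r => /eqP; rewrite subr_eq0 => /eqP.
apply: (glue_cover (I := fun c => c * (a - b) = 0)).
  split=> [|c x y xE yE]; first by rewrite mul0r.
  by rewrite mulrDl -mulrA xE yE mulr0 addr0.
move=> i; have [_ _] := loc1 i; apply.
by rewrite rmorphB E subrr.
Qed.

Lemma glue_elt (s : forall i, R1 i) :
  (forall i j, l i j (s i) = r i j (s j)) ->
  exists a, forall i, rho i a = s i.
Proof.
move=> Es; suff [a Ha] : exists a, forall j, rho j a = rho j 1 * s j.
  by exists a => i; rewrite Ha rmorph1 mul1r.
apply: (glue_cover (I := fun c => exists a, forall j, rho j a = rho j c * s j)).
  split=> [|c x y [a Ha] [b Hb]].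
    by exists 0 => j; rewrite !rmorph0 mul0r.
  exists (c * a + b) => j.
  by rewrite !rmorphD !rmorphM Ha Hb mulrDl mulrA.
move=> i; have [_ /(_ (s i)) [a [m Ea]] _] := loc1 i.
have [p Hp] : exists p, forall j, rho j (f i) ^+ p * (rho j a - rho j (f i) ^+ m * s j) = 0.
  apply: fin_bound => [j p q pq E|j].
    by rewrite -(subnK pq) exprD -mulrA E mulr0.
  have [_ _] := loc_r i j; apply.
  rewrite rmorphB rmorphM rmorphXn /= -!lrE -Es -Ea rmorphM rmorphXn.
  by rewrite mulrC subrr.
exists (p + m)%N, (f i ^+ p * a) => j.
have /eqP := Hp j; rewrite mulrBr subr_eq0 => /eqP E.
by rewrite rmorphM !rmorphXn E exprD mulrA.
Qed.

Lemma span_loc (A B : kalg k) (g : A) (psi : khom A B) N a b :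
  is_localization g psi -> is_submod2 N -> span_im psi N (psi a) (psi b) ->
  exists m, N (g ^+ m * a) (g ^+ m * b).
Proof.
case=> _ Ls Lz [N0 N1].
have NZ c x y : N x y -> N (c * x) (c * y).
  by move=> Nxy; rewrite -[c * x]addr0 -[c * y]addr0; apply: N1.
have ND x y x' y' : N x y -> N x' y' -> N (x + x') (y + y').
  by move=> H H'; rewrite -[x]mul1r -[y]mul1r; apply: N1.
move/(_ (fun x y => exists a b m, [/\ N a b, x * psi g ^+ m = psi a
                                    & y * psi g ^+ m = psi b])).
case=> [|x y Nxy|a' [b' [m [Nab Ea Eb]]]].
- split=> [|c x y x' y' [p [q [m [Npq Ex Ey]]]] [p' [q' [m' [Npq' Ex' Ey']]]]].
    by exists 0, 0, 0%N; rewrite !rmorph0 !mul0r.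
  have [d [m1 Ed]] := Ls c.
  exists (g ^+ m' * d * p + g ^+ (m + m1) * p'),
         (g ^+ m' * d * q + g ^+ (m + m1) * q'), (m + m1 + m')%N.
  split; first by apply: ND; apply: NZ.
  + by rewrite rmorphD !rmorphM -Ed -Ex -Ex' !rmorphXn !exprD; ring.
  + by rewrite rmorphD !rmorphM -Ed -Ey -Ey' !rmorphXn !exprD; ring.
- by exists x, y, 0%N; rewrite !mulr1.
- have [p Hp] : exists p, forall j : 'I_2,
      g ^+ p * (if j == 0 then a * g ^+ m - a' else b * g ^+ m - b') = 0.
    apply: fin_bound => [j p q pq E|j].
      by rewrite -(subnK pq) exprD -mulrA E mulr0.
    by apply: Lz; case: ifP => _; rewrite rmorphB rmorphM rmorphXn ?Ea ?Eb subrr.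
  have /eqP := Hp 0; have /eqP := Hp 1 => /=.
  rewrite !mulrBr !subr_eq0 => /eqP Hb /eqP Ha.
  by exists (p + m)%N; rewrite exprD -!mulrA ![g ^+ m * _]mulrC Ha Hb; apply: NZ.
Qed.

End Gluing.

Lemma khom_build (k : fieldType) (A B : kalg k) (h : A -> B) :
  h 1 = 1 -> (forall a b, h (a - b) = h a - h b) ->
  (forall a b, h (a * b) = h a * h b) ->
  (forall c, h (kalg_str A c) = kalg_str B c) ->
  exists phi : khom A B, phi =1 h.
Proof.
move=> h1 hB hM hk.
pose M1 := GRing.isZmodMorphism.Build A B h hB.
pose M2 := GRing.isMonoidMorphism.Build A B h (h1, hM).
pose H : {rmorphism A -> B} := HB.pack h M1 M2.
by exists (@KHom k A B H hk).
Qed.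

Lemma Spec_sheaf (k : fieldType) (A : kalg k) : zariski_sheaf (Spec_fun A).
Proof.
move=> R n f R1 rho R2 l r uf loc1 loc2 lr x Ex.
have /choice [h Eh] a : exists b, forall i, rho i b = x i a.
  apply: (glue_elt uf loc1 loc2 lr) => i j.
  by have := congr1 (fun g : khom _ _ => g a) (Ex i j).
have sep := glue_sep uf loc1.
have [|a b|a b|c|phi Ephi] := @khom_build k A R h.
- apply: sep => i; by rewrite Eh !rmorph1.
- by apply: sep => i; rewrite rmorphB !Eh rmorphB.
- by apply: sep => i; rewrite rmorphM !Eh rmorphM.
- by apply: sep => i; rewrite (Eh _ i) !khomP.
exists phi; split=> [i|psi Epsi].
  by apply: khom_ext => a /=; rewrite Ephi Eh.
apply: khom_ext => a; apply: sep => i; rewrite Ephi Eh -(Epsi i); by [].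
Qed.

Lemma open_setT_subproof (k : fieldType) (X : kfunctor k) :
  open_cond (fun (R : kalg k) (_ : X R) => True).
Proof.
move=> R x; exists (fun a => a = 1) => S phi; split=> // _ I _; apply.
by exists 1; rewrite ?rmorph1.
Qed.

Definition open_setT (k : fieldType) (X : kfunctor k) : open_sub X :=
  OpenSub (@open_setT_subproof k X).

Lemma Spec_is_scheme (k : fieldType) (A : kalg k) : is_scheme (Spec_fun A).
Proof.
split; first exact: Spec_sheaf.
move=> K j x; exists (open_setT _), A, (khom_id A); split=> //; split=> // R y _.
exists y; split; first exact: khom_ext.
by move=> z <-; apply: khom_ext.
Qed.

Definition Spec (k : fieldType) (A : kalg k) : scheme k :=
  MkScheme (Spec_is_scheme A).

Lemma prod_sheaf (k : fieldType) (X Y : kfunctor k) :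
  zariski_sheaf X -> zariski_sheaf Y -> zariski_sheaf (prod_fun X Y).
Proof.
move=> sX sY R n f R1 rho R2 l r uf loc1 loc2 lr x Ex.
have [y1 [E1 U1]] := sX _ _ _ _ _ _ _ _ uf loc1 loc2 lr (fun i => (x i).1)
  (fun i j => congr1 fst (Ex i j)).
have [y2 [E2 U2]] := sY _ _ _ _ _ _ _ _ uf loc1 loc2 lr (fun i => (x i).2)
  (fun i j => congr1 snd (Ex i j)).
exists (y1, y2); split=> [i|[z1 z2] Ez] /=.
  by rewrite E1 E2; case: (x i).
by rewrite (U1 z1) ?(U2 z2) // => i; rewrite -(Ez i).
Qed.

Lemma sval_inj (T : Type) (P : T -> Prop) (x y : {t : T | P t}) :
  sval x = sval y -> x = y.
Proof. by case: x y => [x Px] [y Py] /= xy; apply: eq_exist. Qed.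

Lemma P1_sheaf (k : fieldType) : zariski_sheaf (P1_fun k).
Proof.
move=> R n f R1 rho R2 l r uf loc1 loc2 lr x Ex.
have sep := glue_sep uf loc1.
pose Ni i := sval (x i).
have LN i : is_line (Ni i) := svalP (x i).
have SN i : is_submod2 (Ni i) by case: (LN i).
have EN i j : span_im (l i j) (Ni i) = span_im (r i j) (Ni j).
  by have := congr1 sval (Ex i j).
pose N a b := forall i, Ni i (rho i a) (rho i b).
have NS : is_submod2 N.
  split=> [i|c a b a' b' H H' i]; first by rewrite rmorph0; case: (SN i).
  by rewrite !rmorphD !rmorphM; case: (SN i) => _; apply.
have lift i a b : Ni i a b -> exists m a' b',
    [/\ N a' b', rho i a' = rho i (f i) ^+ m * a
      & rho i b' = rho i (f i) ^+ m * b].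
  move=> Nab; have [_ Ls _] := loc1 i.
  have [a1 [ma Ea]] := Ls a; have [b1 [mb Eb]] := Ls b.
  have [m Hm] : exists m, forall j, Ni j
     (rho j (f i ^+ m * (f i ^+ mb * a1))) (rho j (f i ^+ m * (f i ^+ ma * b1))).
    apply: fin_bound => [j p q pq H|j].
      rewrite -(subnK pq) exprD -!(mulrA (f i ^+ (q - p))) !(rmorphM (rho j) (f i ^+ (q - p))).
      case: (SN j) => N0 N1.
      by rewrite -[X in Ni j X _]addr0 -[X in Ni j _ X]addr0; apply: N1.
    have : span_im (r i j) (Ni j) (r i j (rho j (f i ^+ mb * a1)))
                                  (r i j (rho j (f i ^+ ma * b1))).
      rewrite -!(lrE lr) -EN !(rmorphM (rho i)) -Ea -Eb !rmorphXn.
      have [_ S1] := span_im_submod (l i j) (Ni i).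
      have [S0 _] := span_im_submod (l i j) (Ni i).
      have := S1 (l i j (rho i (f i)) ^+ (ma + mb)) _ _ 0 0 (span_im_gen (phi:=l i j) Nab) S0.
      rewrite !addr0; set x1 := (X in span_im _ _ X _).
      set y1 := (X in span_im _ _ _ X) => H.
      set x2 := (X in span_im _ _ X _); set y2 := (X in span_im _ _ _ X).
      have -> : x2 = x1 by rewrite /x1 /x2 !rmorphM !rmorphXn exprD; ring.
      by have -> : y2 = y1 by rewrite /y1 /y2 !rmorphM !rmorphXn exprD; ring.
    move/(span_loc (loc_r loc1 loc2 lr i j) (SN j)) => [m].
    move=> Hm; exists m.
    by rewrite !(rmorphM (rho j) (f i ^+ m)) !(rmorphXn (rho j)).
  exists (m + (ma + mb))%N, (f i ^+ m * (f i ^+ mb * a1)), (f i ^+ m * (f i ^+ ma * b1)).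
  by split; rewrite // !rmorphM !rmorphXn -?Ea -?Eb !exprD; ring.
have spanN i : span_im (rho i) N = Ni i.
  apply/funext => a; apply/funext => b; apply/propext; split.
    by move/(_ _ (SN i)); apply=> c d; apply.
  move=> /lift [m [a' [b' [Nab Ea Eb]]]].
  have [[u u1] _ _] := loc1 i.
  have [S0 S1] := span_im_submod (rho i) N.
  have := S1 (u ^+ m) _ _ 0 0 (span_im_gen (phi:=rho i) Nab) S0.
  by rewrite !addr0 Ea Eb !mulrA -!exprMn u1 expr1n !mul1r.
have NL : is_line N.
  split=> // [a b c d Nab Ncd|I [I0 I1] HI].
    apply: sep => i; rewrite rmorphB !rmorphM rmorph0.
    by case: (LN i) => _ H _; apply: H.
  apply: (glue_cover uf) => // i.
  have [_ Ls Lz] := loc1 i.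
  have IZ c a : I a -> I (c * a) by move=> Ia; rewrite -[c * a]addr0; apply: I1.
  have [_ _ /(_ (fun x => exists m a, I a /\ x * rho i (f i) ^+ m = rho i a))] := LN i.
  case=> [|a [b Hab]|m [a [Ia Ea]]].
  - split=> [|c a b [m [a' [Ia Ea]]] [p [b' [Ib Eb]]]].
      by exists 0%N, 0; rewrite rmorph0 mul0r.
    have [d [q Ed]] := Ls c.
    exists (q + m + p)%N, (f i ^+ p * d * a' + f i ^+ (q + m) * b'); split.
      by apply: I1 => //; apply: IZ.
    by rewrite rmorphD !rmorphM -Ed -Ea -Eb !rmorphXn !exprD; ring.
  - case: Hab => /lift [m [a' [b' [Nab Ea Eb]]]].
      exists m, a'; rewrite Ea mulrC; split=> //; apply: HI; exists b'; by left.
    exists m, b'; rewrite Eb mulrC; split=> //; apply: HI; exists a'; by right.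
  - have /Lz [p] : rho i (f i ^+ m - a) = 0.
      by rewrite rmorphB rmorphXn -Ea mul1r subrr.
    move/eqP; rewrite mulrBr subr_eq0 -exprD => /eqP E.
    by exists (p + m)%N; rewrite E; apply: IZ.
exists (exist _ N NL); split=> [i|[N' LN'] EN'].
  by apply: (@sval_inj _ (@is_line (R1 i))); apply: spanN.
apply: eq_exist => /=; apply/funext => a; apply/funext => b; apply/propext.
have E i : span_im (rho i) N' = Ni i by have := congr1 sval (EN' i).
split=> [Nab|H i]; last by rewrite -E; apply: span_im_gen.
have [[N0 N1] _ _] := LN'.
rewrite -[a]mul1r -[b]mul1r.
apply: (glue_cover (I := fun c => N' (c * a) (c * b)) uf).
  split=> [|c p q Hp Hq]; first by rewrite !mul0r.
  by rewrite !mulrDl -!mulrA; apply: N1.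
move=> i; apply: (span_loc (loc1 i)) => //.
by rewrite E; apply: Nab.
Qed.

Lemma nz_kalg (k : fieldType) (A : kalg k) : (1 : A) <> 0 ->
  exists (B : comNzRingType) (j : {rmorphism k -> B})
         (f : khom A (@KAlg k B j)) (g : khom (@KAlg k B j) A),
    cancel f g /\ cancel g f.
Proof.
case: A => A str /= /eqP n10.
pose M := GRing.PzSemiRing_isNonZero.Build A n10.
pose B : comNzRingType := HB.pack (GRing.ComPzRing.sort A) M.
pose M1 := GRing.isZmodMorphism.Build k B str (rmorphB str).
pose M2 := GRing.isMonoidMorphism.Build k B str (rmorph1 str, rmorphM str).
pose j : {rmorphism k -> B} := HB.pack (str : k -> B) M1 M2.
exists B, j.
have [||||f Ef] := @khom_build k (KAlg str) (KAlg j) id; try by [].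
have [||||g Eg] := @khom_build k (KAlg j) (KAlg str) id; try by [].
by exists f, g; split=> a; rewrite Ef Eg.
Qed.

(* the universal property of A[t], also when A or R is the zero ring *)
Lemma poly_kalg (k : fieldType) (A : kalg k) : (1 : A) <> 0 ->
  exists (P : kalg k) (c : khom A P) (t : P),
  forall (R : kalg k) (phi : khom A R) (s : R),
    exists! psi : khom P R, khom_comp psi c = phi /\ psi t = s.
Proof.
move=> /nz_kalg [B [j [f [g [fK gK]]]]].
pose P : kalg k := @KAlg k {poly B} (polyC \o j : {rmorphism _ -> _}).
pose c0 : khom (KAlg j) P := @KHom k (KAlg j) P polyC (fun=> erefl).
exists P, (khom_comp c0 f), ('X : {poly B}) => R phi s.
have [psi [Hc Ht]] : exists psi : khom P R, (forall b, psi (c0 b) = phi (g b)) /\ psi ('X : {poly B}) = s.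
  have [R0|R1] := pselect ((1 : R) = 0).
    have all0 (a b : R) : a = b by rewrite -[a]mulr1 -[b]mulr1 R0 !mulr0.
    have [|? ?|? ?|?|psi _] := @khom_build k P R (fun=> 0); try exact: all0.
    by exists psi; split=> *; apply: all0.
  have [D [jD [u [v [uK vK]]]]] := nz_kalg R1.
  pose h : {rmorphism B -> D} := (u \o phi \o g : {rmorphism _ -> _}).
  have hs : commr_rmorph h (u s) by move=> x; apply: mulrC.
  have [||||e Ee] := @khom_build k P (KAlg jD) (horner_morph hs).
  - by rewrite rmorph1.
  - by move=> a b; rewrite rmorphB.
  - by move=> a b; rewrite rmorphM.
  - move=> a; rewrite /= horner_morphC /= (khomP g a : g (j a) = _).
    by rewrite (khomP phi) (khomP u).
  exists (khom_comp v e); split=> [b|] /=; rewrite Ee.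
    by rewrite /= horner_morphC /= uK.
  by rewrite horner_morphX uK.
exists psi; split=> [|psi' [Hc' Ht']].
  by split=> //; apply: khom_ext => a /=; rewrite (Hc (f a)) fK.
apply: khom_ext; elim/poly_ind => [|p b IH]; first by rewrite !rmorph0.
rewrite !(rmorphD, rmorphM) IH Ht Ht'; congr (_ + _).
rewrite (Hc b) -Hc' /=; congr (psi' _%:P); exact: gK.
Qed.

Section Chart.
Variable k : fieldType.

Definition swp (R : Type) (b : bool) (N : R -> R -> Prop) x y :=
  if b then N y x else N x y.

Lemma swp_line (R : comPzRingType) b (N : R -> R -> Prop) :
  is_line N -> is_line (swp b N).
Proof.
case: b => // -[[N0 N1] Nd Nu]; split=> /=.
- by split=> // c x y x' y'; apply: N1.
- move=> x y z t H H'; have := Nd _ _ _ _ H' H; rewrite /swp => E.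
  by rewrite -E; ring.
- move=> I II HI; apply: (Nu I II) => a [d Hd]; apply: HI; exists d.
  by case: Hd; [right|left].
Qed.

Lemma swp_span (R S : comPzRingType) (phi : R -> S) b (N : R -> R -> Prop) :
  span_im phi (swp b N) = swp b (span_im phi N).
Proof.
case: b => //; apply/funext => x; apply/funext => y; apply/propext; split=> H M [M0 M1] HM.
  by apply: (H (fun p q => M q p)) => [|p q]; [split=> // *; apply: M1|apply: HM].
by apply: (H (fun p q => M q p)) => [|p q]; [split=> // *; apply: M1|apply: HM].
Qed.

Lemma swpK (R : Type) b (N : R -> R -> Prop) : swp b (swp b N) = N.
Proof. by case: b. Qed.

(* the line spanned by (1, t) *)
Definition graph (R : comPzRingType) (t x y : R) : Prop := y = x * t.

Lemma graph_line (R : comPzRingType) (t : R) : is_line (graph t).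
Proof.
split; rewrite /graph.
- by split=> [|c a b a' b' -> ->]; [rewrite mul0r|rewrite mulrDl mulrA].
- by move=> a b c d -> ->; ring.
- by move=> I _; apply; exists t; left; rewrite mul1r.
Qed.

Lemma lineE (R : comPzRingType) (N : R -> R -> Prop) t :
  is_line N -> N 1 t -> N = graph t.
Proof.
move=> [[N0 N1] Nd _] Nt; apply/funext => x; apply/funext => y; apply/propext.
split=> [Nxy|->].
  by have := Nd _ _ _ _ Nt Nxy; rewrite mul1r => /eqP; rewrite subr_eq0 mulrC => /eqP.
by have := N1 x _ _ _ _ Nt N0; rewrite !addr0 mulr1.
Qed.

Lemma span_graph (R S : comPzRingType) (phi : {rmorphism R -> S}) t :
  span_im phi (graph t) = graph (phi t).
Proof.
apply: lineE; first exact: span_im_line (graph_line t).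
by rewrite -(rmorph1 phi); apply: span_im_gen; rewrite /graph mul1r.
Qed.

Lemma chart_open (R S : comPzRingType) (phi : {rmorphism R -> S}) N :
  is_line N ->
  (exists t, span_im phi N 1 t) <-> unit_ideal (im_set phi (fun a => exists b, N a b)).
Proof.
move=> LN; split=> [[t Ht] I [I0 I1] HI|].
  apply: (Ht (fun x _ => I x)); first by split=> // *; apply: I1.
  by move=> a b Nab; apply: HI; exists a => //; exists b.
move/(_ (fun a => exists b, span_im phi N a b)); apply; last first.
  by move=> _ [a [b Nab] ->]; exists (phi b); apply: span_im_gen.
have [S0 S1] := span_im_submod phi N.
split=> [|c a b [a' Ha] [b' Hb]]; first by exists 0.
by exists (c * a' + b'); apply: S1.
Qed.

Lemma im_set_mul (R S : comPzRingType) (phi : {rmorphism R -> S}) (E F : R -> Prop) :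
  unit_ideal (im_set phi (fun c => exists a b, [/\ E a, F b & c = a * b])) <->
  unit_ideal (im_set phi E) /\ unit_ideal (im_set phi F).
Proof.
split=> [H|[HE HF] I [I0 I1] HI].
  split=> I [I0 I1] HI; apply: (H I) => // _ [_ [a [b [Ea Fb ->]]] ->].
    rewrite mulrC rmorphM -[X in I X]addr0; apply: I1 => //.
    by apply: HI; exists a.
  rewrite rmorphM -[X in I X]addr0; apply: I1 => //.
  by apply: HI; exists b.
apply: (HE I) => // _ [a Ea ->]; rewrite -[phi a]mul1r.
apply: (HF (fun c => I (c * phi a))).
  split=> [|c x y Ix Iy]; first by rewrite mul0r.
  by rewrite mulrDl -mulrA; apply: I1.
move=> _ [b Fb ->]; apply: HI; exists (a * b); first by exists a, b.
by rewrite rmorphM mulrC.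
Qed.

Variables (U : kfunctor k) (V : open_sub U) (b : bool).

Definition chart_mem (R : kalg k) (x : prod_fun (P1_fun k) U R) : Prop :=
  (exists t, swp b (sval x.1) 1 t) /\ open_mem V x.2.

Lemma chart_memP : open_cond chart_mem.
Proof.
move=> R [N u]; have [F HF] := open_memP V u.
exists (fun c => exists x y,
  [/\ (fun a => exists d, swp b (sval N) a d) x, F y & c = x * y]).
move=> S phi; rewrite im_set_mul /chart_mem /= -swp_span chart_open ?HF //.
exact: swp_line (svalP N).
Qed.

Definition chart : open_sub (prod_fun (P1_fun k) U) := OpenSub chart_memP.

Lemma chart_represented (A : kalg k) (a : U A) : (1 : A) <> 0 ->
  represents V a ->
  exists (P : kalg k) (p : prod_fun (P1_fun k) U P), represents chart p.
Proof.
move=> A0 [Va Ha]; have [P [c [t HP]]] := poly_kalg A0.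
pose N : P1_fun k P := exist _ (swp b (graph t)) (swp_line b (graph_line t)).
exists P, (N, fmap U c a); split.
  split; last exact: open_stable.
  by exists t; rewrite /= swpK /graph mul1r.
move=> R [N' u] [[s /= Hs] Vu].
have EN' : swp b (sval N') = graph s.
  by apply: lineE => //; apply: swp_line (svalP N').
have [phi [Ephi Uphi]] := Ha _ _ Vu.
have [psi [[Ec Et] Upsi]] := HP R phi s.
have fmN (psi' : khom P R) : fmap (P1_fun k) psi' N = N' <-> psi' t = s.
  split=> [/(congr1 sval) /= E|E].
    have : graph s 1 (psi' t).
      by rewrite -EN' -E -swp_span swpK span_graph /graph mul1r.
    by rewrite /graph mul1r.
  apply: (@sval_inj _ (@is_line R)) => /=.
  by rewrite swp_span span_graph E -EN' swpK.
exists psi; split=> [|psi' E].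
  by congr (_, _); [apply/fmN|rewrite -fmap_comp Ec].
apply: Upsi; split; last by apply/fmN; exact: (congr1 fst E).
by apply/esym/Uphi; rewrite fmap_comp; exact: (congr1 snd E).
Qed.

End Chart.

Lemma field_line (K : fieldType) (N : K -> K -> Prop) : is_line N ->
  exists b t, swp b N 1 t.
Proof.
case=> [[N0 N1] Nd Nu].
have inv a d b : a != 0 -> swp b N a d -> exists b t, swp b N 1 t.
  move=> a0 H; exists b, (a^-1 * d).
  case: b H => /= H.
    by have := N1 a^-1 _ _ _ _ H N0; rewrite !addr0 mulVf.
  by have := N1 a^-1 _ _ _ _ H N0; rewrite !addr0 mulVf.
have [//|H] := pselect (exists b t, swp b N 1 t).
have /eqP := @oner_neq0 K; case.
apply: (Nu (fun a => a = 0)); first by split=> // c a b -> ->; rewrite mulr0 addr0.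
move=> a [d Hd]; have [//|a0] := eqVneq a 0; case: H.
by case: Hd => Hd; [apply: (inv a d false)|apply: (inv a d true)].
Qed.

Lemma P1_over_is_scheme (k : fieldType) (U : scheme k) :
  is_scheme (prod_fun (P1_fun k) U).
Proof.
have [sU cU] := schemeP U.
split; first by apply: prod_sheaf => //; apply: P1_sheaf.
move=> K j [N u]; have [V [A [a [HV Vu]]]] := cU K j u.
have A0 : (1 : A) <> 0.
  move=> A0; have [phi _] := HV.2 _ _ Vu.
  have /eqP := @oner_neq0 K; case.
  by rewrite -[1](rmorph1 phi) A0 rmorph0.
have [b [t Ht]] := field_line (svalP N).
have [P [p Hp]] := chart_represented b A0 HV.
by exists (chart V b), P, p; split=> //; split=> //; exists t.
Qed.

Definition P1_over (k : fieldType) (U : scheme k) : scheme k :=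
  MkScheme (P1_over_is_scheme U).

(* Points of the underlying space |X| are represented by K-points of X, for  *)
(* K a field over k; open subsets of |X| are open subfunctors, and closed    *)
(* subsets their complements on field-valued points.                         *)

Definition open_nonempty (k : fieldType) (X : kfunctor k)
    (V : open_sub X) : Prop :=
  exists (K : fieldType) (j : {rmorphism k -> K}) (x : X (field_alg j)),
    open_mem V x.

Definition open_dense (k : fieldType) (X : kfunctor k)
    (V : open_sub X) : Prop :=
  forall W : open_sub X, open_nonempty W ->
  exists (K : fieldType) (j : {rmorphism k -> K}) (x : X (field_alg j)),
    open_mem W x /\ open_mem V x.

Definition scheme_nonempty (k : fieldType) (X : kfunctor k) : Prop :=
  exists (K : fieldType) (j : {rmorphism k -> K}), inhabited (X (field_alg j)).

Definition open_immersion_onto (k : fieldType) (U X : kfunctor k)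
    (i : nat_trans U X) (V : open_sub X) : Prop :=
  (forall R : kalg k, injective (@ntrans k U X i R)) /\
  (forall (R : kalg k) (x : X R), open_mem V x <-> exists u : U R, i R u = x).

Definition open_immersion (k : fieldType) (U X : kfunctor k)
    (i : nat_trans U X) : Prop :=
  exists V : open_sub X, open_immersion_onto i V.

Definition locally_finite_type (k : fieldType) (X : kfunctor k) : Prop :=
  forall (K : fieldType) (j : {rmorphism k -> K}) (x : X (field_alg j)),
  exists (V : open_sub X) (A : kalg k) (a : X A),
    [/\ represents V a, fin_gen A & open_mem V x].

Definition finite_type (k : fieldType) (X : kfunctor k) : Prop :=
  exists (n : nat) (V : 'I_n -> open_sub X) (A : 'I_n -> kalg k)
    (a : forall i, X (A i)),
    (forall i, represents (V i) (a i) /\ fin_gen (A i)) /\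
    forall (K : fieldType) (j : {rmorphism k -> K}) (x : X (field_alg j)),
      exists i, open_mem (V i) x.

(* The diagonal X -> X x X is a closed immersion: its pullback along each    *)
(* Spec R -> X x X is Spec (R / (E)) for some E.                             *)
Definition separated (k : fieldType) (X : kfunctor k) : Prop :=
  forall (R : kalg k) (x y : X R), exists E : R -> Prop,
  forall (S : kalg k) (phi : khom R S),
    fmap X phi x = fmap X phi y <-> (forall a, E a -> phi a = 0).

(* For every Y, the image in Y of the closed complement of an open O in      *)
(* X x Y is the closed complement of an open O'.  A point of Y lies in that  *)
(* image when it lifts after some extension e of its field of definition.    *)
Definition universally_closed (k : fieldType) (X : kfunctor k) : Prop :=
  forall (Y : scheme k) (O : open_sub (prod_fun X Y)), exists O' : open_sub Y,
  forall (K : fieldType) (j : {rmorphism k -> K}) (y : Y (field_alg j)),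
    ~ open_mem O' y <->
    exists (K' : fieldType) (j' : {rmorphism k -> K'})
      (e : khom (field_alg j) (field_alg j')) (x : X (field_alg j')),
      ~ @open_mem k (prod_fun X Y) O (field_alg j') (x, fmap Y e y).

Definition variety (k : fieldType) (X : kfunctor k) : Prop :=
  separated X /\ finite_type X.

Definition is_proper (k : fieldType) (X : kfunctor k) : Prop :=
  [/\ separated X, finite_type X & universally_closed X].

(* Nonempty, and the ring of every nonempty affine open is a domain. *)
Definition integral (k : fieldType) (X : kfunctor k) : Prop :=
  scheme_nonempty X /\
  forall (V : open_sub X) (A : kalg k) (a : X A),
    represents V a -> (1 : A) <> 0 ->
    forall b c : A, b * c = 0 -> b = 0 \/ c = 0.

Definition formally_smooth (k : fieldType) (X : kfunctor k) : Prop :=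
  forall (B C : kalg k) (phi : khom B C),
    (forall c, exists b, phi b = c) ->
    (forall a b, phi a = 0 -> phi b = 0 -> a * b = 0) ->
    forall y : X C, exists x : X B, fmap X phi x = y.

(* Over a field, locally of finite type and locally of finite presentation   *)
(* agree, so this is smoothness in the sense of EGA IV 17.3.1.               *)
Definition smooth (k : fieldType) (X : kfunctor k) : Prop :=
  locally_finite_type X /\ formally_smooth X.

Definition generically_smooth (k : fieldType) (X : kfunctor k) : Prop :=
  exists (U : scheme k) (i : nat_trans U X) (V : open_sub X),
    [/\ open_immersion_onto i V, open_dense V & smooth U].

Definition R_linked (L : fieldType) (V : kfunctor L)
    (A B : V (base_alg L)) : Prop :=
  exists (W : open_sub (P1_fun L)) (h : nat_trans (open_subfunctor W) V)
    (a b : open_subfunctor W (base_alg L)),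
    h (base_alg L) a = A /\ h (base_alg L) b = B.

Definition R_equiv (L : fieldType) (V : kfunctor L) :
    V (base_alg L) -> V (base_alg L) -> Prop :=
  clos_refl_trans (V (base_alg L)) (@R_linked L V).

(* By definition X_L(L) is X evaluated at L, viewed as a k-algebra along j.  *)
Definition almost_R_trivial (k : fieldType) (X : kfunctor k) : Prop :=
  exists U : open_sub X, open_dense U /\
  forall (L : fieldType) (j : {rmorphism k -> L}),
  exists P : base_change j X (base_alg L),
    @open_mem k X U (restr_alg j (base_alg L)) P /\
    forall Q : base_change j X (base_alg L),
      @open_mem k X U (restr_alg j (base_alg L)) Q -> R_equiv P Q.

Record scheme_presheaf (k : fieldType) := SchemePresheaf {
  psh_obj :> scheme k -> Type;
  psh_map : forall X Y : scheme k, nat_trans X Y -> psh_obj Y -> psh_obj X;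
  psh_id : forall (X : scheme k) a, psh_map (nt_id X : nat_trans X X) a = a;
  psh_comp : forall (X Y Z : scheme k)
      (g : nat_trans Y Z) (f : nat_trans X Y) a,
    psh_map (nt_comp g f : nat_trans X Z) a = psh_map f (psh_map g a) }.

Arguments psh_map {k} F {X Y} f a : rename.

Definition P1_proj (k : fieldType) (U : scheme k) :
    nat_trans (P1_over U) U :=
  @proj2_fun k (P1_fun k) U.

Lemma structure_map_subproof (k : fieldType) (X : kfunctor k)
    (A B : kalg k) (f : khom A B) (x : X A) :
  str_hom B = fmap (Spec_fun (base_alg k)) f (str_hom A).
Proof. by apply: khom_ext => c /=; rewrite khomP. Qed.

Definition structure_map (k : fieldType) (X : scheme k) :
    nat_trans X (Spec (base_alg k)) :=
  @NatTrans k X (Spec_fun (base_alg k)) (fun A _ => str_hom A)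
    (@structure_map_subproof k X).

(* Main.v *)
(* Over the function field K of X, the generic point is R-equivalent to the   *)
(* image of a rational point P of X.  By properness the maps W -> X from opens *)
(* W of P^1_K extend to P^1_K; each extended map is defined over P^1_U for a   *)
(* small smooth affine open U = Spec A[1/f] of X.  Since F(U) -> F(P^1_U) is   *)
(* bijective, all sections of P^1_U -> U induce the same map F(P^1_U) -> F(U), *)
(* so along the chain the inclusion U -> X and the constant map U -> X with    *)
(* value P induce the same map F(X) -> F(U).                                   *)

Require Import Defs.
From HB Require Import structures.
From mathcomp Require Import all_boot all_algebra all_field.
From mathcomp Require Import boolp ring.

Set Implicit Arguments.
Unset Strict Implicit.
Unset Printing Implicit Defensive.
Import GRing.Theory.
Local Open Scope ring_scope.

(** * Localization *)

(** The principle is that [F] cannot tell apart two sections of [P^1_U -> U]. By hypothesis every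
    class on [P^1_U] is pulled back from [U], and all sections restrict such a class in the same way
    ([sections_equal]). So two morphisms [U -> X] that arise from one morphism [P^1_U -> X] by
    composing with two sections induce the same map [F(X) -> F(U)]. Let [K] be the function field of
    [X]. Almost R-triviality, applied over [k] and over [K], joins the generic point of [X] to a
    constant point coming from [X(k)] by links, that is, by maps to [X] from open subsets of
    [P^1_K]. Each link has to become a morphism from [P^1_U], with the same [U] for all links.
    Properness removes the poles: near any point of the affine line a [K(t)]-point of [X] has
    coordinates that are fractions with denominator nonzero at that point ([valuative]), and the
    local pieces glue because [X] is separated. All of this involves finitely many elements of [K],
    so it already happens over any subring of [K] containing them. The predicate [large] records
    such a condition, and [large_and] combines finitely many of them ([extension], [link_spread],
    [R_equiv_spread]). The line [P^1] is treated as two affine lines exchanged by [t -> 1/t].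
    Finally [generic_model] provides [U = Spec A[1/f]] inside the smooth locus whose ring contains
    the required elements. On [F(X)] the inclusion of [U] and the constant map then agree, which
    gives one inclusion of images; the other holds because the structure map of [U] factors through
    [X]. *)

Section LocRing.
Local Open Scope quotient_scope.
Variables (R : comPzRingType) (D : R -> Prop).
Hypothesis D1 : D 1.
Hypothesis DM : forall a b, D a -> D b -> D (a * b).

(** Membership in [D] is made boolean so that fractions form a subtype and inherit the choice
    structure needed by the quotient. *)
Definition loc_frac := {x : R * R | `[< D x.2 >]}.
Implicit Types x y z : loc_frac.

Definition mkfrac (a d : R) (Dd : D d) : loc_frac :=
  exist (fun x : R * R => `[< D x.2 >]) (a, d) (asboolT Dd).

Lemma fracP x : D (sval x).2. Proof. by case: x => x /= /asboolP. Qed.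

Definition loc_eqv x y : bool := `[< exists2 p, D p &
  p * ((sval x).1 * (sval y).2 - (sval y).1 * (sval x).2) = 0 >].

Lemma loc_eqvP : equiv_class_of loc_eqv.
Proof.
split=> [x|x y|y x z].
- by apply/asboolP; exists 1 => //; rewrite subrr mulr0.
- by apply/asboolP/asboolP => -[p Dp E]; exists p => //; rewrite -opprB mulrN E oppr0.
- move=> /asboolP[p Dp E] /asboolP[q Dq E']; apply/asboolP.
  exists (p * q * (sval y).2); first by apply: DM (fracP y); apply: DM.
  transitivity (q * (sval z).2 * (p * ((sval x).1 * (sval y).2 - (sval y).1 * (sval x).2))
    + p * (sval x).2 * (q * ((sval y).1 * (sval z).2 - (sval z).1 * (sval y).2))); first by ring.
  by rewrite E E' !mulr0 addr0.
Qed.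

Canonical loc_equiv := EquivRelPack loc_eqvP.
Definition loc_ring := {eq_quot loc_equiv}.
HB.instance Definition _ : EqQuotient _ loc_equiv loc_ring := EqQuotient.on loc_ring.
HB.instance Definition _ := Choice.on loc_ring.

Definition mk a d (Dd : D d) : loc_ring := \pi_loc_ring (mkfrac a Dd).

Lemma mkP a d (Dd : D d) a' d' (Dd' : D d') :
  mk a Dd = mk a' Dd' <-> exists2 p, D p & p * (a * d' - a' * d) = 0.
Proof.
split=> [/eqquotP/asboolP //|H].
by apply/eqquotP/asboolP.
Qed.

Lemma mk_ind (P : loc_ring -> Prop) : (forall a d (Dd : D d), P (mk a Dd)) -> forall u, P u.
Proof.
move=> H; elim/quotW => -[[a d] /= Dd].
suff -> : exist _ (a, d) Dd = mkfrac a (asboolW Dd) by apply: H.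
exact: val_inj.
Qed.

Definition loc_op (h : loc_frac -> loc_frac -> loc_frac) (u v : loc_ring) : loc_ring :=
  \pi_loc_ring (h (repr u) (repr v)).

Definition add_frac x y := mkfrac ((sval x).1 * (sval y).2 + (sval y).1 * (sval x).2)
  (DM (fracP x) (fracP y)).
Definition mul_frac x y := mkfrac ((sval x).1 * (sval y).1) (DM (fracP x) (fracP y)).
Definition opp_frac x := mkfrac (- (sval x).1) (fracP x).

Definition loc_add : loc_ring -> loc_ring -> loc_ring := loc_op add_frac.
Definition loc_mul : loc_ring -> loc_ring -> loc_ring := loc_op mul_frac.
Definition loc_opp (u : loc_ring) : loc_ring := \pi_loc_ring (opp_frac (repr u)).

Lemma repr_mk a d (Dd : D d) : exists2 p, D p &
  p * ((sval (repr (mk a Dd))).1 * d - a * (sval (repr (mk a Dd))).2) = 0.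
Proof.
have : repr (mk a Dd) = mkfrac a Dd %[mod loc_ring] by rewrite reprK.
by move=> /eqquotP/asboolP.
Qed.

Lemma pi_mk x : \pi_loc_ring x = mk (sval x).1 (fracP x).
Proof. by congr (\pi_loc_ring _); apply: val_inj; case: x => [[]]. Qed.

Lemma loc_addE a d (Dd : D d) a' d' (Dd' : D d') :
  loc_add (mk a Dd) (mk a' Dd') = mk (a * d' + a' * d) (DM Dd Dd').
Proof.
rewrite /loc_add /loc_op pi_mk; apply/mkP => /=.
have [p Dp E] := repr_mk a Dd; have [q Dq E'] := repr_mk a' Dd'.
set x := sval (repr (mk a Dd)) in E *; set y := sval (repr (mk a' Dd')) in E' *.
exists (p * q); first exact: DM.
transitivity (q * y.2 * d' * (p * (x.1 * d - a * x.2)) + p * x.2 * d * (q * (y.1 * d' - a' * y.2))); first by ring.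
by rewrite E E' !mulr0 addr0.
Qed.

Lemma loc_mulE a d (Dd : D d) a' d' (Dd' : D d') :
  loc_mul (mk a Dd) (mk a' Dd') = mk (a * a') (DM Dd Dd').
Proof.
rewrite /loc_mul /loc_op pi_mk; apply/mkP => /=.
have [p Dp E] := repr_mk a Dd; have [q Dq E'] := repr_mk a' Dd'.
set x := sval (repr (mk a Dd)) in E *; set y := sval (repr (mk a' Dd')) in E' *.
exists (p * q); first exact: DM.
transitivity (q * y.1 * d' * (p * (x.1 * d - a * x.2)) + p * a * x.2 * (q * (y.1 * d' - a' * y.2))); first by ring.
by rewrite E E' !mulr0 addr0.
Qed.

Lemma loc_oppE a d (Dd : D d) : loc_opp (mk a Dd) = mk (- a) Dd.
Proof.
rewrite /loc_opp pi_mk; apply/mkP => /=.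
have [p Dp E] := repr_mk a Dd; exists p => //.
by rewrite -[RHS]oppr0 -E; ring.
Qed.

Definition loc0 := mk 0 D1.
Definition loc1 := mk 1 D1.

Lemma eq_mk a d (Dd : D d) a' d' (Dd' : D d') : a = a' -> d = d' -> mk a Dd = mk a' Dd'.
Proof. by move=> -> E; apply/mkP; exists 1; rewrite ?E ?subrr ?mulr0. Qed.

Lemma loc_addA : associative loc_add.
Proof.
elim/mk_ind => a d Dd; elim/mk_ind => a' d' Dd'; elim/mk_ind => b e De.
by rewrite !loc_addE; apply: eq_mk; ring.
Qed.
Lemma loc_addC : commutative loc_add.
Proof.
elim/mk_ind => a d Dd; elim/mk_ind => a' d' Dd'.
by rewrite !loc_addE; apply: eq_mk; ring.
Qed.
Lemma loc_add0 : left_id loc0 loc_add.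
Proof. by elim/mk_ind => a d Dd; rewrite !loc_addE; apply: eq_mk; ring. Qed.
Lemma loc_addN : left_inverse loc0 loc_opp loc_add.
Proof.
elim/mk_ind => a d Dd; rewrite loc_oppE loc_addE; apply/mkP; exists 1 => //.
by ring.
Qed.
Lemma loc_mulA : associative loc_mul.
Proof.
elim/mk_ind => a d Dd; elim/mk_ind => a' d' Dd'; elim/mk_ind => b e De.
by rewrite !loc_mulE; apply: eq_mk; ring.
Qed.
Lemma loc_mulC : commutative loc_mul.
Proof.
elim/mk_ind => a d Dd; elim/mk_ind => a' d' Dd'.
by rewrite !loc_mulE; apply: eq_mk; ring.
Qed.
Lemma loc_mul1 : left_id loc1 loc_mul.
Proof. by elim/mk_ind => a d Dd; rewrite !loc_mulE; apply: eq_mk; ring. Qed.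
Lemma loc_mulD : left_distributive loc_mul loc_add.
Proof.
elim/mk_ind => a d Dd; elim/mk_ind => a' d' Dd'; elim/mk_ind => b e De.
rewrite !(loc_mulE, loc_addE); apply/mkP; exists 1 => //; ring.
Qed.

HB.instance Definition _ :=
  GRing.isZmodule.Build loc_ring loc_addA loc_addC loc_add0 loc_addN.
HB.instance Definition _ :=
  GRing.Zmodule_isComPzRing.Build loc_ring loc_mulA loc_mulC loc_mul1 loc_mulD.

Lemma mkD a d (Dd : D d) b : mk a Dd + mk b Dd = mk (a + b) Dd.
Proof. by rewrite [LHS]loc_addE; apply/mkP; exists 1 => //; ring. Qed.

Lemma mkM a d (Dd : D d) a' d' (Dd' : D d') : mk a Dd * mk a' Dd' = mk (a * a') (DM Dd Dd').
Proof. exact: loc_mulE. Qed.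

Lemma mkN a d (Dd : D d) : - mk a Dd = mk (- a) Dd.
Proof. exact: loc_oppE. Qed.

Definition loc_map a := mk a D1.

Lemma loc_map_zmod : zmod_morphism loc_map.
Proof. by move=> a b; rewrite mkN mkD. Qed.

Lemma loc_map_monoid : monoid_morphism loc_map.
Proof. by split=> // a b; rewrite mkM; apply: eq_mk; rewrite ?mulr1. Qed.

HB.instance Definition _ := GRing.isZmodMorphism.Build R loc_ring loc_map loc_map_zmod.
HB.instance Definition _ := GRing.isMonoidMorphism.Build R loc_ring loc_map loc_map_monoid.

End LocRing.

(** The analogue of [is_localization] for any set [D] of denominators, so that [R[1/f]] and fraction
    fields share one universal property. *)
Definition loc_at (k : fieldType) (R S : kalg k) (D : R -> Prop) (rho : khom R S) :=
  [/\ forall d, D d -> exists u, u * rho d = 1,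
      forall s, exists r d, D d /\ s * rho d = rho r
    & forall r, rho r = 0 -> exists2 d, D d & d * r = 0].

Lemma loc_at_ex (k : fieldType) (R : kalg k) (D : R -> Prop) :
  D 1 -> (forall a b, D a -> D b -> D (a * b)) ->
  exists (S : kalg k) (rho : khom R S), loc_at D rho.
Proof.
move=> D1 DM.
pose S : kalg k := @KAlg k (loc_ring D1 DM) (loc_map D1 DM \o kalg_str R : {rmorphism _ -> _}).
pose rho : khom R S := @KHom k R S (loc_map D1 DM) (fun=> erefl).
exists S, rho; split=> [d Dd|s|r].
- exists (mk D1 DM 1 Dd); rewrite [LHS]mkM; apply/mkP; exists 1 => //; ring.
- elim/mk_ind: s => r d Dd; exists r, d; split=> //.
  by rewrite [LHS]mkM; apply/mkP; exists 1 => //; ring.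
- by move/mkP => [p Dp E]; exists p => //; rewrite -[RHS]E; ring.
Qed.

Section Lift.
Variables (k : fieldType) (R S : kalg k) (D : R -> Prop) (rho : khom R S).
Hypothesis L : loc_at D rho.

Lemma loc_at_eq (T : kalg k) (f g : khom S T) :
  khom_comp f rho = khom_comp g rho -> f = g.
Proof.
case: L => Lu Ls _ E; apply: khom_ext => s; have [r [d [Dd Es]]] := Ls s.
have [u Eu] := Lu d Dd.
have E' a : f (rho a) = g (rho a) by have := congr1 (fun h : khom _ _ => h a) E.
have v : g u * g (rho d) = 1 by rewrite -rmorphM Eu rmorph1.
have Ed : f s * g (rho d) = g s * g (rho d) by rewrite -E' -rmorphM Es E' -Es rmorphM E'.
by rewrite -[f s]mulr1 -[g s]mulr1 -v (mulrC (g u)) !mulrA Ed.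
Qed.

(** The image of [s] must be the [t] with [t * phi d = phi r] whenever [s * rho d = rho r]. It does
    not depend on the presentation because each [phi d] is a unit, so the ring laws can be checked
    after multiplying by denominators. *)
Lemma loc_at_lift (T : kalg k) (phi : khom R T) :
  (forall a b, D a -> D b -> D (a * b)) ->
  (forall d, D d -> exists u, u * phi d = 1) ->
  exists psi : khom S T, khom_comp psi rho = phi.
Proof.
case: L => Lu Ls Lz DM Hu.
have cancel_unit d x y : D d -> x * phi d = y * phi d -> x = y.
  move=> /Hu [u Eu] E; rewrite -[x]mulr1 -[y]mulr1 -Eu (mulrC u) !mulrA.
  by rewrite E.
have /choice [h Hh] s : exists t, forall r d, D d -> s * rho d = rho r -> t * phi d = phi r.
  have [r [d [Dd E]]] := Ls s; have [u Eu] := Hu d Dd.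
  exists (phi r * u) => r' d' Dd' E'.
  have /Lz [e De E2] : rho (r * d' - r' * d) = 0.
    by rewrite rmorphB !rmorphM -E -E'; ring.
  apply: (cancel_unit e) => //; apply: (cancel_unit d) => //.
  apply/eqP; rewrite -subr_eq0; apply/eqP.
  transitivity (phi (e * (r * d' - r' * d)) + phi r * phi d' * phi e * (u * phi d - 1)).
    by rewrite !(rmorphM, rmorphB) /=; ring.
  by rewrite E2 Eu rmorph0 subrr mulr0 addr0.
have h_rho r d s : D d -> s * rho d = rho r -> h s * phi d = phi r by move=> *; apply: Hh.
have hr r d : D d -> h (rho r) = phi r.
  by move=> Dd; apply: (cancel_unit d) => //; rewrite -rmorphM; apply: Hh => //; rewrite rmorphM.
have [d0 [D0]] : exists d, D d /\ True by have [r [d [Dd _]]] := Ls 1; exists d.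
have [||||psi Epsi] := @khom_build k S T h.
- by rewrite -(rmorph1 rho) (hr _ d0) // rmorph1.
- move=> a b; have [r [d [Dd E]]] := Ls a; have [r' [d' [Dd' E']]] := Ls b.
  have Dm := DM _ _ Dd Dd'; apply: (cancel_unit (d * d')) => //.
  rewrite (@h_rho (r * d' - r' * d)) //.
    by rewrite rmorphB !rmorphM -(h_rho _ _ _ Dd E) -(h_rho _ _ _ Dd' E'); ring.
  by rewrite rmorphB !rmorphM -E -E'; ring.
- move=> a b; have [r [d [Dd E]]] := Ls a; have [r' [d' [Dd' E']]] := Ls b.
  have Dm := DM _ _ Dd Dd'; apply: (cancel_unit (d * d')) => //.
  rewrite (@h_rho (r * r')) //.
    by rewrite !rmorphM -(h_rho _ _ _ Dd E) -(h_rho _ _ _ Dd' E'); ring.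
  by rewrite !rmorphM -E -E'; ring.
- by move=> c; rewrite -(khomP rho) (hr _ d0) // khomP.
by exists psi; apply: khom_ext => r /=; rewrite Epsi (hr _ d0).
Qed.

End Lift.

Definition powers (R : comPzRingType) (f a : R) : Prop := exists n, a = f ^+ n.

Lemma powers1 (R : comPzRingType) (f : R) : powers f 1.
Proof. by exists 0%N. Qed.

Lemma powersM (R : comPzRingType) (f a b : R) : powers f a -> powers f b -> powers f (a * b).
Proof. by case=> n -> [m ->]; exists (n + m)%N; rewrite exprD. Qed.

Lemma exp_unit (R : comPzRingType) (u f : R) n : u * f = 1 -> u ^+ n * f ^+ n = 1.
Proof. by move=> E; rewrite -exprMn E expr1n. Qed.

Lemma localization_at (k : fieldType) (R S : kalg k) (f : R) (rho : khom R S) :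
  is_localization f rho <-> loc_at (powers f) rho.
Proof.
split=> -[Lu Ls Lz]; split.
- move=> _ [n ->]; have [u Eu] := Lu; exists (u ^+ n).
  by rewrite rmorphXn exp_unit.
- move=> s; have [r [n E]] := Ls s; exists r, (f ^+ n).
  by rewrite rmorphXn E; split=> //; exists n.
- by move=> r /Lz [n E]; exists (f ^+ n) => //; exists n.
- by apply: Lu; exists 1%N.
- by move=> s; have [r [_ [[n ->] E]]] := Ls s; exists r, n; rewrite -E rmorphXn.
- by move=> r /Lz [_ [n ->] E]; exists n.
Qed.

Definition loc_pair (k : fieldType) (R : kalg k) (f : R) :
  {p : {S : kalg k & khom R S} | is_localization f (projT2 p)}.
Proof.
apply: cid; have [S [rho H]] := @loc_at_ex k R (powers f) (powers1 f) (@powersM R f).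
by exists (existT _ S rho); apply/localization_at.
Qed.

Definition Loc (k : fieldType) (R : kalg k) (f : R) : kalg k := projT1 (sval (loc_pair f)).
Definition loc (k : fieldType) (R : kalg k) (f : R) : khom R (Loc f) := projT2 (sval (loc_pair f)).

Lemma locP (k : fieldType) (R : kalg k) (f : R) : is_localization f (loc f).
Proof. exact: svalP (loc_pair f). Qed.

Section LocLemmas.
Variables (k : fieldType) (R S : kalg k) (f : R) (rho : khom R S).
Hypothesis L : is_localization f rho.

Lemma localization_eq (T : kalg k) (g h : khom S T) :
  khom_comp g rho = khom_comp h rho -> g = h.
Proof. by move/localization_at: L => L'; apply: loc_at_eq L' _ _ _. Qed.

Lemma localization_lift (T : kalg k) (phi : khom R T) :
  (exists u, u * phi f = 1) -> exists psi : khom S T, khom_comp psi rho = phi.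
Proof.
move/localization_at: L => L' [u Eu]; apply: (loc_at_lift L').
  exact: powersM.
by move=> _ [n ->]; exists (u ^+ n); rewrite rmorphXn exp_unit.
Qed.

End LocLemmas.

Lemma unit_ideal_sub (R : comPzRingType) (E F : R -> Prop) :
  (forall a, E a -> F a) -> unit_ideal E -> unit_ideal F.
Proof. by move=> EF uE I HI IF; apply: uE => // a /EF /IF. Qed.

Lemma unit_ideal_fin (R : comPzRingType) (E : R -> Prop) : unit_ideal E ->
  exists n (e c : 'I_n -> R), (forall i, E (e i)) /\ \sum_i c i * e i = 1.
Proof.
move=> uE; suff : exists s : seq (R * R), (forall p, p \in s -> E p.2) /\ \sum_(p <- s) p.1 * p.2 = 1.
  case=> s [sE s1]; exists (size s), (fun i => (tnth (in_tuple s) i).2),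
    (fun i => (tnth (in_tuple s) i).1); split=> [i|]; first by apply/sE/mem_tnth.
  by rewrite -s1 [RHS]big_tnth.
apply: (uE (fun a => exists s : seq (R * R), (forall p, p \in s -> E p.2) /\ \sum_(p <- s) p.1 * p.2 = a)).
  split=> [|c a b [s [sE sa]] [t [tE tb]]]; first by exists [::]; rewrite big_nil.
  exists ([seq (c * p.1, p.2) | p <- s] ++ t); split=> [p|].
    by rewrite mem_cat => /orP[/mapP[q /sE qE ->] //|/tE].
  rewrite big_cat big_map tb -sa mulr_sumr; congr (_ + _).
  by apply: eq_bigr => p _; rewrite mulrA.
move=> a Ea; exists [:: (1, a)]; split=> [p|]; first by rewrite inE => /eqP ->.
by rewrite big_seq1 mul1r.
Qed.

Lemma unit_ideal_comb (R : comPzRingType) n (e c : 'I_n -> R) :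
  \sum_i c i * e i = 1 -> unit_ideal (fun a => exists i, a = e i).
Proof.
move=> s1 I [I0 I1] HI; rewrite -[X in I X]s1; apply: (big_ind I) => // [x y Ix Iy|i _].
  by rewrite -[x]mul1r; apply: I1.
by rewrite -[X in I X]addr0; apply: I1 => //; apply: HI; exists i.
Qed.

Lemma field_unit_ideal (K : fieldType) (E : K -> Prop) :
  unit_ideal E <-> exists2 a, E a & a != 0.
Proof.
split=> [uE|[a Ea a0] I [I0 I1] /(_ a Ea) Ia].
  have [//|H] := pselect (exists2 a, E a & a != 0); case/eqP: (oner_neq0 K).
  apply: (uE (fun a => a = 0)) => [|a Ea].
    by split=> // c a b -> ->; rewrite mulr0 addr0.
  by have [//|a0] := eqVneq a 0; case: H; exists a.
by have := I1 a^-1 _ _ Ia I0; rewrite addr0 mulVf.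
Qed.

Lemma im_set_comp (A B C : Type) (f : A -> B) (g : B -> C) E :
  im_set g (im_set f E) = im_set (g \o f) E.
Proof.
apply/funext => c; apply/propext; split=> [[_ [a Ea ->] ->]|[a Ea ->]].
  by exists a.
by exists (f a) => //; exists a.
Qed.

(** * Gluing sections over standard open covers *)

Section Sheaf.
Variables (k : fieldType) (X : kfunctor k).
Hypothesis sX : zariski_sheaf X.

Lemma sheaf_glue (R : kalg k) n (e c : 'I_n -> R) (x : forall i, X (Loc (e i))) :
  \sum_i c i * e i = 1 ->
  (forall i j (l : khom (Loc (e i)) (Loc (e i * e j))) (r : khom (Loc (e j)) (Loc (e i * e j))),
     khom_comp l (loc (e i)) = loc (e i * e j) -> khom_comp r (loc (e j)) = loc (e i * e j) ->
     fmap X l (x i) = fmap X r (x j)) ->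
  exists! y : X R, forall i, fmap X (loc (e i)) y = x i.
Proof.
move=> s1 Hx.
have Hl i j : exists l : khom (Loc (e i)) (Loc (e i * e j)), khom_comp l (loc (e i)) = loc (e i * e j).
  apply: (localization_lift (locP (e i))); have [[u u1] _ _] := locP (e i * e j).
  by exists (u * loc (e i * e j) (e j)); rewrite -u1 rmorphM; ring.
have Hr i j : exists r : khom (Loc (e j)) (Loc (e i * e j)), khom_comp r (loc (e j)) = loc (e i * e j).
  apply: (localization_lift (locP (e j))); have [[u u1] _ _] := locP (e i * e j).
  by exists (u * loc (e i * e j) (e i)); rewrite -u1 rmorphM; ring.
pose l i j := sval (cid (Hl i j)); pose r i j := sval (cid (Hr i j)).
have El i j : khom_comp (l i j) (loc (e i)) = loc (e i * e j) := svalP (cid (Hl i j)).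
have Er i j : khom_comp (r i j) (loc (e j)) = loc (e i * e j) := svalP (cid (Hr i j)).
apply: (sX (f := e) (rho := fun i => loc (e i)) (l := l) (r := r)).
- exact: unit_ideal_comb s1.
- by move=> i; apply: locP.
- by move=> i j; rewrite El; apply: locP.
- by move=> i j; rewrite El Er.
- by move=> i j; apply: Hx.
Qed.

Lemma sheaf_eq (R : kalg k) (E : R -> Prop) (x y : X R) : unit_ideal E ->
  (forall e, E e -> fmap X (loc e) x = fmap X (loc e) y) -> x = y.
Proof.
move=> /unit_ideal_fin [n [e [c [He s1]]]] Exy.
have [|z [_ Uz]] := @sheaf_glue R n e c (fun i => fmap X (loc (e i)) x) s1.
  by move=> i j l r El Er; rewrite -!fmap_comp El Er.
by rewrite -(Uz x) // -(Uz y) // => i; rewrite -Exy.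
Qed.

(** Descent for a section described by a relation [Q]: naturality and uniqueness of values make
    local solutions agree on overlaps. Compatibility with an arbitrary base change is checked on the
    pulled back cover. *)
Lemma sheaf_local (R : kalg k) (Q : forall S : kalg k, khom R S -> X S -> Prop) :
  (forall S T (phi : khom R S) (psi : khom S T) x, Q S phi x -> Q T (khom_comp psi phi) (fmap X psi x)) ->
  (forall S (phi : khom R S) x y, Q S phi x -> Q S phi y -> x = y) ->
  unit_ideal (fun e => exists x, Q _ (loc e) x) ->
  exists! y : X R, forall S phi x, Q S phi x -> fmap X phi y = x.
Proof.
move=> Qn Qf /unit_ideal_fin [n [e [c [He s1]]]].
pose x i := sval (cid (He i)).
have Hx i : Q _ (loc (e i)) (x i) := svalP (cid (He i)).
have [|y [Ey Uy]] := @sheaf_glue R n e c x s1.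
  move=> i j l r El Er; apply: (Qf _ (loc (e i * e j))).
    by rewrite -El; apply: Qn.
  by rewrite -Er; apply: Qn.
exists y; split=> [S phi z Qz|y' Hy']; last by apply: Uy => i; apply: Hy'.
apply: (sheaf_eq (unit_ideal_im (phi := phi) (unit_ideal_comb s1))) => _ [_ [i ->] ->].
have [|phi' Ephi] := @localization_lift _ _ _ _ _ (locP (e i)) _ (khom_comp (loc (phi (e i))) phi).
  by case: (locP (phi (e i))).
apply: (Qf _ (khom_comp (loc (phi (e i))) phi)); last exact: Qn.
by rewrite -fmap_comp -Ephi fmap_comp Ey; apply: Qn.
Qed.

End Sheaf.

(** * Open subfunctors *)

Section Opens.
Variables (k : fieldType) (X : kfunctor k).

Definition open_spec (V : open_sub X) (R : kalg k) (x : X R) (E : R -> Prop) : Prop :=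
  forall (S : kalg k) (phi : khom R S), open_mem V (fmap X phi x) <-> unit_ideal (im_set phi E).

Lemma open_spec_im (V : open_sub X) (R S : kalg k) (phi : khom R S) (x : X R) E :
  open_spec V x E -> open_spec V (fmap X phi x) (im_set phi E).
Proof. by move=> H T psi; rewrite im_set_comp -fmap_comp; apply: (H _ (khom_comp psi phi)). Qed.

Lemma open_spec_id (V : open_sub X) (R : kalg k) (x : X R) E :
  open_spec V x E -> open_mem V x <-> unit_ideal E.
Proof. by move=> /(_ _ (khom_id R)); rewrite fmap_id im_set_id. Qed.

Lemma ideal_mul (R : comPzRingType) (I : R -> Prop) c a : is_ideal I -> I a -> I (c * a).
Proof. by move=> [I0 I1] Ia; rewrite -[X in I X]addr0; apply: I1. Qed.

(** Clearing denominators turns an expression of 1 over [R[1/f]] into an expression of a power of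
    [f] over [R]. *)
Lemma unit_ideal_loc (R S : kalg k) (f : R) (rho : khom R S) (F I : R -> Prop) :
  is_localization f rho -> unit_ideal (im_set rho F) -> is_ideal I ->
  (forall a, F a -> I a) -> exists n, I (f ^+ n).
Proof.
case=> _ Ls Lz uF II FI; have [I0 I1] := II.
have [||n [a [Ia E]]] := uF (fun s => exists n a, I a /\ s * rho f ^+ n = rho a).
- split=> [|c a b [n [a' [Ia Ea]]] [m [b' [Ib Eb]]]]; first by exists 0%N, 0; rewrite rmorph0 mul0r.
  have [r [p Er]] := Ls c; exists (p + n + m)%N, (f ^+ m * r * a' + f ^+ (p + n) * b'); split.
    by apply: I1 => //; apply: ideal_mul.
  by rewrite !(rmorphD, rmorphM) -Ea -Eb -Er !rmorphXn !exprD; ring.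
- by move=> _ [a Fa ->]; exists 0%N, a; split; [apply: FI|rewrite mulr1].
have [|m Em] := Lz (f ^+ n - a); first by rewrite rmorphB rmorphXn -E mul1r subrr.
exists (m + n)%N; move/eqP: Em; rewrite mulrBr subr_eq0 exprD => /eqP ->.
exact: ideal_mul.
Qed.

(** The union is defined by the sum of the ideals of its members. After a base change, a new
    equation [e'] of a member is compared with the old ones on [D(e')], where that member is
    everything. Only field-valued points are described, since a ring-valued point may lie in members
    of the family only locally. *)
Lemma open_union (P : open_sub X -> Prop) : exists O : open_sub X,
  forall (K : fieldType) (j : {rmorphism k -> K}) (x : X (field_alg j)),
  open_mem O x <-> exists2 V : open_sub X, P V & open_mem V x.
Proof.
pose U (R : kalg k) (x : X R) (e : R) := exists V E, [/\ P V, open_spec V x E & E e].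
have HO : open_cond (fun (R : kalg k) (x : X R) => unit_ideal (U R x)).
  move=> R x; exists (U R x) => S phi; split=> H; last first.
    apply: unit_ideal_sub H => _ [e [V [E [PV HE Ee]]] ->].
    by exists V, (im_set phi E); split=> //; [apply: open_spec_im|exists e].
  move=> I II HI; apply: (unit_ideal_exp H) => // e' [V [E' [PV HE' Ee']]].
  have [E HE] := open_memP V x.
  apply: (unit_ideal_loc (F := im_set phi E) (locP e')) => //; last first.
    by move=> _ [e Ee ->]; apply: HI; exists e => //; exists V, E.
  rewrite im_set_comp; apply/(HE _ (khom_comp (loc e') phi)); rewrite fmap_comp.
  apply/HE' => J [J0 J1] HJ; have [[u <-] _ _] := locP e'.
  by rewrite -[X in J X]addr0; apply: J1 => //; apply: HJ; exists e'.
exists (OpenSub HO) => K j x; split=> [/= /field_unit_ideal [e [V [E [PV HE Ee]]] e0]|[V PV Vx] /=].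
  by exists V => //; apply/(open_spec_id HE)/field_unit_ideal; exists e.
have [E HE] := open_memP V x.
by move/(open_spec_id HE): Vx; apply: unit_ideal_sub => e Ee; exists V, E.
Qed.

(* [G] is the graph of a function on [V]; the conclusion is its nonvanishing locus. *)
Lemma basic_open (V : open_sub X) (G : forall R : kalg k, X R -> R -> Prop) :
  (forall R (x : X R), open_mem V x -> exists g, G R x g) ->
  (forall R (x : X R) g h, G R x g -> G R x h -> g = h) ->
  (forall R S (phi : khom R S) x g, G R x g -> G S (fmap X phi x) (phi g)) ->
  exists O : open_sub X, forall (R : kalg k) (x : X R),
    open_mem O x <-> open_mem V x /\ exists g u, G R x g /\ u * g = 1.
Proof.
move=> Gt Gf Gn.
suff HO : open_cond (fun (R : kalg k) x => open_mem V x /\ exists g u, G R x g /\ u * g = 1).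
  by exists (OpenSub HO).
move=> R x; have [E HE] := open_memP V x.
(* If the function is [r / e ^ n] on [D(e)], then [D(e * r)] is the part of [D(e)] where it is
   invertible. *)
pose E2 c := exists e n r g, [/\ E e, c = e * r, G _ (fmap X (loc e) x) g & g * loc e e ^+ n = loc e r].
have key (S : kalg k) (phi : khom R S) g' e n r g : G _ (fmap X phi x) g' ->
    G _ (fmap X (loc e) x) g -> g * loc e e ^+ n = loc e r ->
    exists m, phi e ^+ m * (g' * phi e ^+ n - phi r) = 0.
  move=> Gg' Gg Er.
  have [|phi' Ephi] := @localization_lift _ _ _ _ _ (locP e) _ (khom_comp (loc (phi e)) phi).
    by case: (locP (phi e)).
  have Ep a : phi' (loc e a) = loc (phi e) (phi a).
    by have := congr1 (fun h : khom _ _ => h a) Ephi.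
  have Eg : phi' g = loc (phi e) g'.
    apply: (Gf _ (fmap X (khom_comp phi' (loc e)) x)); first by rewrite fmap_comp; apply: Gn.
    by rewrite Ephi fmap_comp; apply: Gn.
  have [_ _ Lz] := locP (phi e); apply: Lz.
  by rewrite rmorphB rmorphM rmorphXn -Eg -!Ep -rmorphXn -rmorphM Er subrr.
exists E2 => S phi; split=> [[Vx [g' [u [Gg' Eu]]]] I II HI|uE2].
  have /HE uE := Vx; apply: (unit_ideal_exp uE) => // _ [e Ee ->].
  have [|g Gg] := Gt _ (fmap X (loc e) x).
    apply/HE => J JJ HJ; have [[v <-] _ _] := locP e.
    by apply: ideal_mul => //; apply: HJ; exists e.
  have [_ Ls _] := locP e; have [r [n Er]] := Ls g.
  have [m /eqP] := key _ _ _ _ _ _ _ Gg' Gg Er; rewrite mulrBr subr_eq0 => /eqP Em.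
  exists (m + n).+1.
  have -> : phi e ^+ (m + n).+1 = u * phi e ^+ m * phi (e * r).
    transitivity (u * g' * phi e ^+ (m + n).+1); first by rewrite Eu mul1r.
    transitivity (u * phi e * (phi e ^+ m * (g' * phi e ^+ n))); first by rewrite exprS exprD; ring.
    by rewrite Em rmorphM; ring.
  by apply: ideal_mul => //; apply: HI; exists (e * r) => //; exists e, n, r, g.
have Vx : open_mem V (fmap X phi x).
  apply/HE => I II HI; apply: (uE2) => // _ [_ [e [n [r [g [Ee -> _ _]]]]] ->].
  by rewrite rmorphM mulrC; apply: ideal_mul => //; apply: HI; exists e.
split=> //; have [g' Gg'] := Gt _ _ Vx; exists g'.
suff [u ->] : exists u, 1 = u * g' by exists u.
apply: (unit_ideal_exp (I := fun s => exists u, s = u * g') uE2).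
  split=> [|c _ _ [u ->] [v ->]]; first by exists 0; rewrite mul0r.
  by exists (c * u + v); ring.
move=> _ [_ [e [n [r [g [Ee -> Gg Er]]]]] ->].
have [m /eqP] := key _ _ _ _ _ _ _ Gg' Gg Er; rewrite mulrBr subr_eq0 => /eqP Em.
exists m.+1, (phi e * phi r ^+ m * phi e ^+ n * phi e ^+ m).
transitivity (phi e * phi r ^+ m * (phi e ^+ m * phi r)).
  by rewrite rmorphM exprMn exprSr exprS; ring.
by rewrite -Em; ring.
Qed.

(** The locus where [x] and [y] agree is cut out by equations that become zero in [T], hence are
    zero in [R]. *)
Lemma separated_inj (R T : kalg k) (iota : khom R T) (x y : X R) :
  separated X -> injective iota -> fmap X iota x = fmap X iota y -> x = y.
Proof.
move=> /(_ R x y) [E HE] inj /HE E0.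
by rewrite -[x]fmap_id -[y]fmap_id; apply/HE => a /E0; rewrite -(rmorph0 iota) => /inj.
Qed.

End Opens.

Lemma prod_open (k : fieldType) (X Y : kfunctor k) (V : open_sub X) :
  exists O : open_sub (prod_fun X Y), forall (R : kalg k) (x : prod_fun X Y R),
    open_mem O x <-> open_mem V x.1.
Proof.
suff H : @open_cond k (prod_fun X Y) (fun R x => open_mem V x.1) by exists (OpenSub H).
by move=> R x; have [E HE] := open_memP V x.1; exists E.
Qed.

(* [(x, e y)] lies in the closure of the point [(gamma, beta)] of [X * Spec B]. *)
Lemma closure_point (k : fieldType) (X : kfunctor k) (B : kalg k)
    (T : fieldType) (jT : {rmorphism k -> T}) (beta : khom B (field_alg jT)) (gamma : X (field_alg jT))
    (L : fieldType) (jL : {rmorphism k -> L}) (y : khom B (field_alg jL)) :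
  universally_closed X -> injective beta ->
  exists (L' : fieldType) (jL' : {rmorphism k -> L'}) (e : khom (field_alg jL) (field_alg jL'))
    (x : X (field_alg jL')), forall O : open_sub (prod_fun X (Spec_fun B)),
    @open_mem k _ O (field_alg jL') (x, khom_comp e y) -> @open_mem k _ O (field_alg jT) (gamma, beta).
Proof.
move=> uX binj.
(* The complement of [O] is the closure of the point [(gamma, beta)]. *)
have [O HO] := open_union (fun V : open_sub (prod_fun X (Spec_fun B)) =>
  ~ @open_mem k _ V (field_alg jT) (gamma, beta)).
have [O' HO'] := uX (Spec B) O.
have nb : ~ @open_mem k (Spec B) O' (field_alg jT) beta.
  apply/HO'; exists T, jT, (khom_id _), gamma; rewrite fmap_id.
  by case/HO.
have [E HE] := open_memP O' (khom_id B : Spec B B).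
(* The image of this closure is closed and contains the generic point [beta] of [Spec B], so its
   complement [O'] has zero equations. *)
have E0 e : E e -> e = 0.
  move=> Ee; have [//|e0] := eqVneq e 0; case: nb.
  have -> : beta = fmap (Spec B) beta (khom_id B) by apply: khom_ext.
  apply/HE/field_unit_ideal; exists (beta e); first by exists e.
  by apply: contra_neq e0 => b0; apply: binj; rewrite b0 rmorph0.
have ny : ~ @open_mem k (Spec B) O' (field_alg jL) y.
  have -> : y = fmap (Spec B) y (khom_id B) by apply: khom_ext.
  by move/HE/field_unit_ideal => [_ [e /E0 -> ->]]; rewrite rmorph0 eqxx.
have [L' [jL' [e [x nO]]]] := (HO' _ _ _).1 ny.
exists L', jL', e, x => V Vx; apply: contrapT => nV; apply: nO.
by apply/HO; exists V.
Qed.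

(* The field [T] is the fraction field of the Bezout domain [B]. *)
Lemma valuative (k : fieldType) (X : kfunctor k) (B : kalg k)
    (T : fieldType) (jT : {rmorphism k -> T}) (beta : khom B (field_alg jT)) (gamma : X (field_alg jT))
    (L : fieldType) (jL : {rmorphism k -> L}) (y : khom B (field_alg jL)) :
  universally_closed X -> finite_type X -> injective beta ->
  (forall tau : T, exists u v p q, p * u + q * v = 1 /\ tau * beta v = beta u) ->
  exists (V : open_sub X) (A : kalg k) (a : X A) (psi : khom A (field_alg jT)),
    [/\ represents V a, fin_gen A, fmap X psi a = gamma
      & forall c, exists u v, y v != 0 /\ psi c * beta v = beta u].
Proof.
move=> uX fX binj hB.
have [L' [jL' [e [x Hx]]]] := closure_point gamma y uX binj.
have [n [V [A [a [Ha cX]]]]] := fX; have [i Vx] := cX _ _ x.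
have [rV fA] := Ha i; move: (V i) (A i) (a i) rV fA Vx => {V A a Ha cX} V A a rV fA Vx.
have [W HW] := prod_open (Spec_fun B) V.
(* The preimage of [V] is an open neighbourhood of the specialization [(x, e y)], so it contains
   [(gamma, beta)]. *)
have Vg : open_mem V gamma by have /HW := Hx W ((HW _ (x, khom_comp e y)).2 Vx).
have [psi [Epsi Upsi]] := rV.2 _ _ Vg; have [xi [Exi Uxi]] := rV.2 _ _ Vx.
exists V, A, a, psi; split=> // c.
have [u [v [p [q [E1 Ec]]]]] := hB (psi c).
exists u, v; split=> //; apply/eqP => yv0.
(* [v c - u] vanishes at [(gamma, beta)], hence at [(x, e y)], so [u] and [v] both vanish at [y]. *)
pose G (R : kalg k) (z : prod_fun X (Spec_fun B) R) (g : R) :=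
  exists2 chi : khom A R, fmap X chi a = z.1 & g = z.2 v * chi c - z.2 u.
have [|||O HO] := @basic_open _ _ W G.
- by move=> R z /HW /rV.2 [chi [Echi _]]; exists (z.2 v * chi c - z.2 u), chi.
- move=> R z _ _ [chi Echi ->] [chi' Echi' ->]; suff -> : chi = chi' by [].
  have Vz : open_mem V z.1 by rewrite -Echi; apply: open_stable; case: rV.
  by have [w [_ Uw]] := rV.2 _ _ Vz; rewrite -(Uw _ Echi) -(Uw _ Echi').
- move=> R S phi z _ [chi Echi ->]; exists (khom_comp phi chi) => /=.
    by rewrite fmap_comp Echi.
  by rewrite rmorphB rmorphM.
have : @open_mem k _ O (field_alg jT) (gamma, beta).
  apply: Hx; apply/HO; split; first by apply/HW.
  (* Since [y v = 0], the function takes the value [- e (y u)] at [(x, e y)], and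
     [p * u + q * v = 1] reduces there to [p * u = 1]. *)
  exists (- e (y u)), (- e (y p)); split.
    exists xi => //; change (- e (y u) = e (y v) * xi c - e (y u)).
    have ev0 : e (y v) = 0 by apply: etrans (rmorph0 e); congr (e _); exact: yv0.
    by rewrite ev0 mul0r sub0r.
  rewrite mulrNN -!rmorphM; transitivity (e (y 1)); last by rewrite !rmorph1.
  rewrite -E1; congr (e _); apply/esym; rewrite rmorphD !rmorphM [X in _ + _ * X]yv0 mulr0 addr0; exact: erefl.
case/HO => _ [g [w [[chi Echi ->] /eqP]]] /=.
rewrite -(Upsi _ Echi) [beta v * _]mulrC Ec subrr mulr0.
by rewrite eq_sym oner_eq0.
Qed.

(** * Extending and spreading out maps from the generic point of P^1_K *)

Section FractionField.
Variables (k : fieldType) (A : kalg k).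
Hypothesis A1 : (1 : A) <> 0.
Hypothesis dom : forall b c : A, b * c = 0 -> b = 0 \/ c = 0.

Lemma fraction_field : exists (F : fieldType) (j : {rmorphism k -> F})
  (iota : khom A (field_alg j)), loc_at (fun a => a <> 0) iota.
Proof.
have [|S [rho L]] := @loc_at_ex k A (fun a => a <> 0) A1.
  by move=> a b a0 b0 /dom [].
have [Lu Ls Lz] := L.
have S1 : (1 : S) <> 0.
  by rewrite -(rmorph1 rho) => /Lz [d d0]; rewrite mulr1.
have [B [j [f [g [fK gK]]]]] := nz_kalg S1.
(* The field structure requires the inverse of 0 to be 0. *)
have /choice [inv Hin] (x : B) : exists y, (x != 0 -> y * x = 1) /\ (x = 0 -> y = 0).
  have [->|x0] := eqVneq x 0; first by exists 0.
  have [r [d [d0 E]]] := Ls (g x).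
  have [u Eu] : exists u, u * rho r = 1.
    apply: (Lu) => r0; case/eqP: x0; rewrite -[x]gK.
    have [v Ev] := Lu d d0.
    by rewrite -[g x]mulr1 -Ev (mulrC v) mulrA E r0 rmorph0 mul0r rmorph0.
  exists (f (u * rho d)); split=> [_|x00]; last by rewrite x00 eqxx in x0.
  by rewrite -[X in _ * X]gK -rmorphM -mulrA (mulrC (rho d)) E Eu rmorph1.
pose M := GRing.ComNzRing_isField.Build B (fun x => (Hin x).1) ((Hin 0).2 erefl).
pose F : fieldType := HB.pack (GRing.ComNzRing.sort B) M.
exists F, (j : {rmorphism k -> F}), (khom_comp f rho : khom A (@field_alg k F j)).
split=> [d /Lu [u Eu]|x|r /(congr1 g) /=]; first by exists (f u); rewrite -rmorphM Eu rmorph1.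
  have [r [d [d0 E]]] := Ls (g x); exists r, d; split=> //.
  by rewrite -[x]gK /= -rmorphM E.
by rewrite fK rmorph0 => /Lz.
Qed.
End FractionField.

(** * Polynomials over a field: common zeros and reduced fractions *)

Lemma irreducible_factor (K : fieldType) (p : {poly K}) : (1 < size p)%N ->
  exists2 q, irreducible_poly q & q %| p.
Proof.
have [n] := ubnP (size p); elim: n p => // n IH p pn p1.
have [irr|] := pselect (irreducible_poly p); first by exists p; rewrite ?dvdpp.
move=> nirr; have [d [d1 dp nd]] : exists d : {poly K}, [/\ size d != 1%N, d %| p & ~~ (d %= p)].
  apply: contrapT => H; apply: nirr; split=> // d d1 dp; apply: contrapT => /negP nd.
  by apply: H; exists d.
have p0 : p != 0 by rewrite -size_poly_gt0 ltnW.
have d0 : d != 0 by apply: contraNneq p0 => d0; rewrite -dvd0p -d0.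
have [||q qirr qd] := IH d; last by exists q => //; apply: dvdp_trans qd dp.
  have := dvdp_leq p0 dp; rewrite leq_eqVlt dvdp_size_eqp // (negbTE nd) /= => h.
  exact: leq_trans h _.
by rewrite ltn_neqAle eq_sym d1 size_poly_gt0.
Qed.

(** A weak Nullstellensatz in one variable. A nonzero element of least degree divides the whole
    ideal; were it not constant, a root of an irreducible factor, in an extension of [K], would be a
    common zero of [E]. *)
Lemma poly_unit_ideal (K : fieldType) (E : {poly K} -> Prop) :
  (forall (L : fieldType) (s : {rmorphism K -> L}) (z : L),
     exists2 g, E g & (map_poly s g).[z] != 0) -> unit_ideal E.
Proof.
move=> H I II EI; have [I0 I1] := II.
have [g0 Eg0 g00] := H K idfun 0.
have g0n0 : g0 != 0 by apply: contraNneq g00 => ->; rewrite rmorph0 horner0.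
have exn : exists n, `[< exists d : {poly K}, [/\ I d, d != 0 & size d = n] >].
  by exists (size g0); apply/asboolP; exists g0; split=> //; apply: EI.
case: (ex_minnP exn) => n /asboolP[d [Id d0 <-]] dmin.
have ddiv g : I g -> d %| g.
  move=> Ig; apply/modp_eq0P/eqP; apply: contraTT isT => r0.
  have := dmin (size (g %% d)); rewrite leqNgt ltn_modp d0 => -> //.
  apply/asboolP; exists (g %% d); split=> //.
  have -> : g %% d = - (g %/ d) * d + g by rewrite {3}(divp_eq g d); ring.
  exact: I1.
have [d1|d1] := leqP (size d) 1.
  have dc := size1_polyC d1; have c0 : d`_0 != 0 by apply: contra_neq d0 => c0; rewrite dc c0.
  have -> : 1 = (d`_0)^-1%:P * d + 0 by rewrite [X in _ * X]dc -polyCM mulVf // addr0.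
  exact: I1.
have [q qirr qd] := irreducible_factor d1.
have [L _ [z zq _]] := irredp_FAdjoin qirr.
have [g Eg] := H L (in_alg L) z; case/eqP.
have /dvdpP [h ->] := dvdp_trans qd (ddiv _ (EI _ Eg)).
by rewrite rmorphM hornerM (rootP zq) mulr0.
Qed.

(** Dividing by the gcd and applying Bezout puts a fraction in the comaximal form that [valuative]
    asks for. *)
Lemma coprime_fraction (K T : fieldType) (beta : {poly K} -> T) (tau : T) :
  {morph beta : x y / x * y} -> (forall a, beta a = 0 -> a = 0) ->
  (exists a b, b <> 0 /\ tau * beta b = beta a) ->
  exists u v p q : {poly K}, p * u + q * v = 1 /\ tau * beta v = beta u.
Proof.
move=> bM binj [a [b [/eqP b0 E]]].
have gn0 : (b != 0) || (a != 0) by rewrite b0.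
have /Bezout_eq1_coprimepP [[q p] /= E1] := coprimep_div_gcd gn0.
exists (a %/ gcdp b a), (b %/ gcdp b a), p, q; split; first by rewrite addrC.
have g0 : beta (gcdp b a) != 0.
  by apply: contraNneq b0 => /binj /eqP; rewrite gcdp_eq0 => /andP[].
by apply: (mulIf g0); rewrite -mulrA -!bM !divpK ?dvdp_gcdl ?dvdp_gcdr.
Qed.

Definition generates (k : fieldType) (A : kalg k) (s : seq A) : Prop :=
  forall P : A -> Prop, (forall c, P (kalg_str A c)) ->
    (forall a b, P a -> P b -> P (a + b)) -> (forall a b, P a -> P b -> P (a * b)) ->
    (forall a, a \in s -> P a) -> forall a, P a.

(** The elements of [A] whose image lies in [R] form a subalgebra. Hence finitely many conditions
    suffice to descend a map, which is what makes descent a [large] property. *)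
Lemma generates_lift (k : fieldType) (A R T : kalg k) (s : seq A) (psi : khom A T) (iota : khom R T) :
  generates s -> injective iota -> (forall c, c \in s -> exists r, iota r = psi c) ->
  exists psi' : khom A R, khom_comp iota psi' = psi.
Proof.
move=> gs inj Hs.
have /choice [h Hh] c : exists r, iota r = psi c.
  apply: (gs (fun c => exists r, iota r = psi c)) => [{}c|a b [r Er] [r' Er']|a b [r Er] [r' Er']|//].
  - by exists (kalg_str R c); rewrite !khomP.
  - by exists (r + r'); rewrite !rmorphD Er Er'.
  - by exists (r * r'); rewrite !rmorphM Er Er'.
have [||||psi' E] := @khom_build k A R h.
- by apply: inj; rewrite Hh !rmorph1.
- by move=> a b; apply: inj; rewrite rmorphB !Hh rmorphB.
- by move=> a b; apply: inj; rewrite rmorphM !Hh rmorphM.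
- by move=> c; apply: inj; rewrite Hh !khomP.
by exists psi'; apply: khom_ext => c /=; rewrite E Hh.
Qed.

Lemma loc_field_inj (k : fieldType) (R S : kalg k) (T : fieldType) (j : {rmorphism k -> T})
    (iota : khom R (field_alg j)) (f : R) (rho : khom R S) :
  is_localization f rho -> injective iota -> f <> 0 ->
  exists2 theta : khom S (field_alg j), khom_comp theta rho = iota & injective theta.
Proof.
move=> L inj f0; have if0 : iota f != 0.
  by apply/eqP => E; apply: f0; apply: inj; rewrite E rmorph0.
have [|theta E] := localization_lift L (phi := iota); first by exists (iota f)^-1; rewrite mulVf.
have E' a : theta (rho a) = iota a by have := congr1 (fun h : khom _ _ => h a) E.
exists theta => // x y /eqP; rewrite -subr_eq0 -rmorphB => /eqP E0.
have [[u u1] Ls _] := L; have [r [n Er]] := Ls (x - y).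
have r0 : r = 0.
  apply: inj; rewrite rmorph0 -E' -Er rmorphM; rewrite [X in X * _]E0; exact: mul0r.
apply/eqP; rewrite -subr_eq0 -[x - y]mulr1 -(expr1n _ n) -u1 exprMn (mulrC (u ^+ n)) mulrA.
by rewrite Er r0 rmorph0 mul0r.
Qed.

Definition poly_alg (k : fieldType) (B : comNzRingType) (jB : {rmorphism k -> B}) : kalg k :=
  @KAlg k {poly B} (polyC \o jB : {rmorphism _ -> _}).

(** * Spreading out from [K] to subrings of [K] *)

Section Spread.
Variables (k K : fieldType) (j : {rmorphism k -> K}).

Definition scal : kalg k := restr_alg j (base_alg K).
Definition polyK : kalg K := @poly_alg K K idfun.

(* The models used are the rings [A[1/f]], for [K] the fraction field of [A]; a    *)
(* property is [large] when it holds as soon as the model contains a given finite *)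
(* subset of [K].                                                                 *)
Record model := Model {
  mring : comNzRingType;
  mstr : {rmorphism k -> mring};
  mmap : khom (@KAlg k mring mstr) scal;
  minj : injective mmap }.

Definition malg (M : model) : kalg k := @KAlg k (mring M) (mstr M).
Definition mpoly (M : model) : kalg k := poly_alg (mstr M).
Definition mmapr (M : model) : {rmorphism mring M -> K} := mmap M.

Lemma mpoly_map_subproof (M : model) (c : k) :
  map_poly (mmapr M) (kalg_str (mpoly M) c) = kalg_str (restr_alg j polyK) c.
Proof. by rewrite /= map_polyC; congr (_%:P); apply: (khomP (mmap M)). Qed.

Definition mpoly_map (M : model) : khom (mpoly M) (restr_alg j polyK) :=
  @KHom k (mpoly M) (restr_alg j polyK) (map_poly (mmapr M) : {rmorphism _ -> _})
    (@mpoly_map_subproof M).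

Lemma mpoly_map_inj M : injective (mpoly_map M).
Proof. exact: (map_inj_poly (@minj M)) (rmorph0 (mmapr M)). Qed.

Definition large (P : model -> Prop) : Prop :=
  exists s : seq K, forall M, (forall x, x \in s -> exists b, mmap M b = x) -> P M.

Lemma large_and P Q : large P -> large Q -> large (fun M => P M /\ Q M).
Proof.
move=> [s Hs] [t Ht]; exists (s ++ t) => M H.
by split; [apply: Hs|apply: Ht] => x xs; apply: H; rewrite mem_cat xs ?orbT.
Qed.

Lemma large_imp (P Q : model -> Prop) : (forall M, P M -> Q M) -> large P -> large Q.
Proof. by move=> PQ [s Hs]; exists s => M /Hs /PQ. Qed.

Lemma large_seq (I : eqType) (r : seq I) (P : I -> model -> Prop) :
  (forall i, i \in r -> large (P i)) -> large (fun M => forall i, i \in r -> P i M).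
Proof.
elim: r => [_|i r IH H]; first by exists [::].
have := large_and (H i (mem_head _ _)) (IH (fun l lr => H l (mem_behead (s := i :: r) lr))).
by apply: large_imp => M [Pi Pr] l; rewrite inE => /orP[/eqP->|/Pr].
Qed.

Lemma large_all (I : finType) (P : I -> model -> Prop) :
  (forall i, large (P i)) -> large (fun M => forall i, P i M).
Proof.
move=> H; apply: large_imp (large_seq (r := enum I) (fun i _ => H i)) => M HM i.
by apply: HM; rewrite mem_enum.
Qed.

Lemma large_elt (x : K) : large (fun M => exists b, mmap M b = x).
Proof. by exists [:: x] => M; apply; rewrite inE. Qed.

Lemma large_poly (p : {poly K}) : large (fun M => exists q, mpoly_map M q = p).
Proof.
exists p => M H.
have /choice [h Hh] (i : nat) : exists b, mmap M b = p`_i.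
  have [pi|pi] := ltnP i (size p); first by apply: H; apply: mem_nth.
  by exists 0; rewrite nth_default //; exact: rmorph0.
exists (\poly_(i < size p) (h i : mring M)) => /=; apply/polyP => i.
rewrite coef_map coef_poly; case: ltnP => [_|pi]; first exact: Hh.
by rewrite nth_default //; exact: rmorph0 (mmapr M).
Qed.

Variables (T : fieldType) (jT : {rmorphism K -> T}) (beta : khom polyK (field_alg jT)).
Hypothesis betaL : loc_at (fun a => a <> 0) beta.

Definition jkT : {rmorphism k -> T} := jT \o j.
(** By [betaL] the field [T] is [K(t)]; here it is seen over [k]. *)
Definition ratT : kalg k := field_alg jkT.
Definition betak : khom (restr_alg j polyK) ratT := restr_hom j beta.

Lemma beta_inj : injective beta.
Proof.
case: betaL => _ _ Lz x y /eqP; rewrite -subr_eq0 -rmorphB => /eqP /Lz [d d0 /eqP].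
by rewrite mulf_eq0 => /orP[/eqP //|]; rewrite subr_eq0 => /eqP.
Qed.

Lemma betak_inj : injective betak.
Proof. exact: beta_inj. Qed.

Definition mrat (M : model) : khom (mpoly M) ratT := khom_comp betak (mpoly_map M).

Lemma mrat_inj M : injective (mrat M).
Proof. by move=> x y /beta_inj /mpoly_map_inj. Qed.

Section Extension.
Variables (X : kfunctor k).
Hypothesis uX : universally_closed X.
Hypothesis fX : finite_type X.
Hypothesis sepX : separated X.
Hypothesis sX : zariski_sheaf X.
Variable gamma : X ratT.

(** The rational map [gamma] from the affine line is regular on [D(g)] with values in a single
    chart, [g] being a common denominator of its coordinates. *)
Definition defined_on (g : {poly K}) : Prop :=
  g <> 0 /\ exists (V : open_sub X) (A : kalg k) (a : X A) (s : seq A) (psi : khom A ratT),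
    [/\ represents V a, generates s, fmap X psi a = gamma
      & forall c, c \in s -> exists u : {poly K}, psi c * betak g = betak u].

(** At each point of the line, [valuative] gives every coordinate of [gamma] a denominator that is
    nonzero there; the product over finitely many generators is a suitable [g]. Then
    [poly_unit_ideal] turns this pointwise statement into a cover. *)
Lemma extension_cover : unit_ideal defined_on.
Proof.
apply: poly_unit_ideal => L s z.
pose ev : {rmorphism {poly K} -> L} := horner_eval z \o map_poly s.
pose jL : {rmorphism k -> L} := s \o j.
have evk (c : k) : ev (kalg_str (restr_alg j polyK) c) = kalg_str (field_alg jL) c.
  by rewrite /= map_polyC /horner_eval hornerC.
pose y := @KHom k (restr_alg j polyK) (field_alg jL) ev evk.
have [|V [A [a [psi [rV [t gt] Epsi Hpsi]]]]] := @valuative k X _ T jkT betak gamma L jL y uX fX betak_inj.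
  move=> tau; apply: coprime_fraction; [exact: rmorphM| |].
    by move=> a a0; apply: beta_inj; rewrite a0 rmorph0.
  by case: betaL => _ /(_ tau) [a [b [b0 E]]] _; exists a, b.
have [g [yg Hg]] : exists g : {poly K}, ev g != 0 /\ forall c, c \in t -> exists u : {poly K}, psi c * betak g = betak u.
  elim: (t) => [|c r [g [yg Hg]]]; first by exists 1; rewrite rmorph1 oner_neq0.
  have [u [v [yv E]]] := Hpsi c; exists (v * g); split=> [|c']; first by rewrite rmorphM mulf_neq0.
  rewrite inE => /orP[/eqP ->|/Hg [u' E']]; first by exists (u * g); rewrite !rmorphM mulrA E.
  by exists (v * u'); rewrite !rmorphM mulrCA E'.
exists g => //; split; last by exists V, A, a, t, psi.
by move=> g0; rewrite g0 rmorph0 eqxx in yg.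
Qed.

(** The model has to contain only the coefficients of [g] and of one numerator for each generator of
    the chart. *)
Lemma large_chart g : defined_on g -> large (fun M => exists g' : mpoly M, mpoly_map M g' = g /\
  exists x : X (Loc g'), forall theta : khom (Loc g') ratT,
    khom_comp theta (loc g') = mrat M -> fmap X theta x = gamma).
Proof.
move=> [g0 [V [A [a [s [psi [rV gs Epsi Hs]]]]]]].
have Hs' c : c \in s -> large (fun M => exists u, psi c * betak g = betak (mpoly_map M u)).
  move=> /Hs [u E]; apply: large_imp (large_poly u) => M [u' Eu].
  by exists u'; rewrite Eu.
apply: large_imp (large_and (large_poly g) (large_seq Hs')) => M [[g' Eg] Hu].
exists g'; split=> //.
have g'0 : g' <> 0 by move=> E; apply: g0; rewrite -Eg E rmorph0.
have [theta Eth thinj] := loc_field_inj (locP g') (@mrat_inj M) g'0.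
have Et b : theta (loc g' b) = mrat M b by rewrite -Eth.
have [|psi' Epsi'] := generates_lift (psi := psi) gs thinj.
  move=> c /Hu [u E]; have [[w Ew] _ _] := locP g'.
  exists (w * loc g' u); rewrite rmorphM Et.
  transitivity (theta w * (psi c * betak g)); first by rewrite E.
  transitivity (psi c * (theta w * betak g)); first by rewrite mulrCA.
  have -> : betak g = theta (loc g' g') by rewrite Et /= Eg.
  by rewrite -rmorphM Ew rmorph1 mulr1.
exists (fmap X psi' a) => theta' Eth'.
have -> : theta' = theta by apply: (localization_eq (locP g')); rewrite Eth' Eth.
by rewrite -fmap_comp Epsi'.
Qed.

(** Extends [gamma] to the affine line and descends it at once. The Bezout relation of the cover
    descends to polynomials over the model, and the pieces agree on overlaps because these embed in
    [K(t)] and [X] is separated. *)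
Lemma extension : large (fun M => exists y : X (mpoly M), fmap X (mrat M) y = gamma).
Proof.
have [n [e [c [He s1]]]] := unit_ideal_fin extension_cover.
have Hc := large_all (fun i => large_poly (c i)).
have Hg := large_all (fun i => large_chart (He i)).
apply: large_imp (large_and Hc Hg) => M [/choice [c' Ec] /choice [e' Ee]].
pose x i := sval (cid (Ee i).2).
have Hx i (theta : khom (Loc (e' i)) ratT) :
  khom_comp theta (loc (e' i)) = mrat M -> fmap X theta (x i) = gamma := svalP (cid (Ee i).2) theta.
have s1' : \sum_i c' i * e' i = 1.
  apply: (@mpoly_map_inj M); rewrite rmorph_sum rmorph1 -[RHS]s1; apply: eq_bigr => i _.
  by rewrite rmorphM Ec (Ee i).1.
pose Q (S : kalg k) (phi : khom (mpoly M) S) (z : X S) :=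
  exists i (chi : khom (Loc (e' i)) S), khom_comp chi (loc (e' i)) = phi /\ z = fmap X chi (x i).
have [|||y [Hy _]] := @sheaf_local _ _ sX (mpoly M) Q.
- move=> S S' phi psi z [i [chi [<- ->]]]; exists i, (khom_comp psi chi).
  by rewrite fmap_comp; split=> //; apply: khom_ext.
- move=> S phi _ _ [i [chi [E ->]]] [l [chi' [E' ->]]].
  have ne i' : e' i' <> 0.
    by move=> E0; apply: (He i').1; rewrite -(Ee i').1 E0 rmorph0.
  (* Since [phi] inverts both denominators, it factors through the overlap, and the comparison can
     be made there. *)
  have [|zeta Ez] := localization_lift (locP (e' i * e' l)) (phi := phi).
    have [[u Eu] _ _] := locP (e' i); have [[v Ev] _ _] := locP (e' l).
    exists (chi u * chi' v); rewrite rmorphM.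
    transitivity (chi u * phi (e' i) * (chi' v * phi (e' l))); first by ring.
    by rewrite -{1}E -E' /= -!rmorphM Eu Ev !rmorph1 mulr1.
  have [[w Ew] _ _] := locP (e' i * e' l).
  have [|li Eli] := localization_lift (locP (e' i)) (phi := loc (e' i * e' l)).
    by exists (w * loc (e' i * e' l) (e' l)); rewrite -Ew rmorphM; ring.
  have [|ll Ell] := localization_lift (locP (e' l)) (phi := loc (e' i * e' l)).
    by exists (w * loc (e' i * e' l) (e' i)); rewrite -Ew rmorphM; ring.
  have -> : chi = khom_comp zeta li.
    apply: (localization_eq (locP (e' i))); rewrite E -Ez -Eli; exact: khom_ext.
  have -> : chi' = khom_comp zeta ll.
    apply: (localization_eq (locP (e' l))); rewrite E' -Ez -Ell; exact: khom_ext.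
  rewrite !fmap_comp; congr (fmap X zeta _).
  have [|theta Eth thinj] := loc_field_inj (locP (e' i * e' l)) (@mrat_inj M).
    move=> /eqP; rewrite -(inj_eq (@mpoly_map_inj M)) rmorphM rmorph0.
    rewrite (Ee i).1 (Ee l).1 mulf_eq0 => /orP[]/eqP; [exact: (He i).1|exact: (He l).1].
  apply: (separated_inj sepX thinj); rewrite -!fmap_comp !Hx //.
    by rewrite -Eth -Ell; apply: khom_ext.
  by rewrite -Eth -Eli; apply: khom_ext.
- apply: unit_ideal_sub (unit_ideal_comb s1') => _ [i ->].
  exists (x i), i, (khom_id _); rewrite fmap_id; split=> //; exact: khom_ext.
(* The cover has a member, because its Bezout sum is 1; the generic value is read off on that
   member. *)
exists y; have [i0 _|n0] := pickP (@predT 'I_n); last first.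
  by have := oner_neq0 {poly K}; rewrite -[1]s1 big_pred0 ?eqxx.
have [|theta Eth _] := loc_field_inj (locP (e' i0)) (@mrat_inj M).
  by move=> E0; apply: (He i0).1; rewrite -(Ee i0).1 E0 rmorph0.
by apply: Hy; exists i0, theta; rewrite Hx.
Qed.

End Extension.
End Spread.

(** * Morphisms from the projective line *)

Section PolyEval.
Variables (k : fieldType) (B : comNzRingType) (jB : {rmorphism k -> B}).
Let A : kalg k := @KAlg k B jB.
Let P : kalg k := poly_alg jB.

Definition const_hom : khom A P := @KHom k A P polyC (fun=> erefl).

Lemma poly_hom_eq (R : kalg k) (f g : khom P R) :
  khom_comp f const_hom = khom_comp g const_hom -> f 'X = g 'X -> f = g.
Proof.
move=> Ec Ex; apply: khom_ext; elim/poly_ind => [|p b IH]; first by rewrite !rmorph0.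
rewrite !(rmorphD, rmorphM) IH Ex; congr (_ + _).
by have := congr1 (fun h : khom A R => h b) Ec.
Qed.

Lemma peval_ex (R : kalg k) (u : khom A R) (s : R) :
  exists psi : khom P R, khom_comp psi const_hom = u /\ psi 'X = s.
Proof.
have [R0|R1] := pselect ((1 : R) = 0).
  have all0 (a b : R) : a = b by rewrite -[a]mulr1 -[b]mulr1 R0 !mulr0.
  have [|? ?|? ?|?|psi _] := @khom_build k P R (fun=> 0); try exact: all0.
  by exists psi; split=> //; apply: khom_ext => a; apply: all0.
have [D [jD [f [g [fK gK]]]]] := nz_kalg R1.
pose u' : {rmorphism B -> D} := f \o u.
have us : commr_rmorph u' (f s) by move=> x; apply: mulrC.
have ek (c : k) : horner_morph us (kalg_str P c) = kalg_str (@KAlg k D jD) c.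
  by rewrite /= horner_morphC; apply: (khomP (khom_comp f u)).
pose e := @KHom k P (@KAlg k D jD) (horner_morph us : {rmorphism _ -> _}) ek.
exists (khom_comp g e); split; last by rewrite /= horner_morphX fK.
by apply: khom_ext => b; rewrite /= horner_morphC /= fK.
Qed.

Definition peval (R : kalg k) (u : khom A R) (s : R) : khom P R := sval (cid (peval_ex u s)).

Lemma peval_const (R : kalg k) (u : khom A R) s : khom_comp (peval u s) const_hom = u.
Proof. exact: (svalP (cid (peval_ex u s))).1. Qed.

Lemma pevalC (R : kalg k) (u : khom A R) s b : peval u s b%:P = u b.
Proof. by rewrite -[in RHS](peval_const u s). Qed.

Lemma pevalX (R : kalg k) (u : khom A R) s : peval u s 'X = s.
Proof. exact: (svalP (cid (peval_ex u s))).2. Qed.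

Lemma peval_comp (R S : kalg k) (phi : khom R S) (u : khom A R) s :
  khom_comp phi (peval u s) = peval (khom_comp phi u) (phi s).
Proof.
apply: poly_hom_eq; last by rewrite /= !pevalX.
by apply: khom_ext => b /=; rewrite !pevalC.
Qed.

Section Glue.
Variables (X : kfunctor k) (y : bool -> X P).
Hypothesis sX : zariski_sheaf X.
Hypothesis yE : forall (R : kalg k) (u : khom A R) s s', s * s' = 1 ->
  fmap X (peval u s) (y false) = fmap X (peval u s') (y true).

(** With [b] false the line passes through [(1, s)], with [b] true through [(s, 1)]. This is a
    relation because a line may lie in either chart, in both, or in neither. *)
Definition chart_val (R : kalg k) (N : P1_fun k R) (u : khom A R) (S : kalg k)
    (phi : khom R S) (x : X S) : Prop :=
  exists b s, swp b (span_im phi (sval N)) 1 s /\ x = fmap X (peval (khom_comp phi u) s) (y b).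

(** Locally every line lies in one of the charts; where it lies in both, its two coordinates are
    inverse to each other and [yE] makes the values coincide. *)
Lemma P1_glue_ex (R : kalg k) (N : P1_fun k R) (u : khom A R) :
  exists! x : X R, forall S (phi : khom R S) z, chart_val N u phi z -> fmap X phi x = z.
Proof.
apply: (sheaf_local sX).
- move=> S S' phi psi _ [b [s [Hs ->]]]; exists b, (psi s); split.
    rewrite [span_im _ _](span_im_comp phi psi) -swp_span -(rmorph1 psi).
    exact: span_im_gen.
  rewrite -fmap_comp peval_comp; congr (fmap X (peval _ _) _); exact: khom_ext.
- move=> S phi _ _ [b [s [Hs ->]]] [b' [s' [Hs' ->]]].
  have [_ Nd _] := span_im_line phi (svalP N).
  case: b b' Hs Hs' => -[] /= Hs Hs'.
  + suff -> : s = s' by [].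
    by apply/eqP; rewrite -subr_eq0; apply/eqP; have := Nd _ _ _ _ Hs Hs'; rewrite mulr1 mul1r.
  + apply/esym/yE; apply/eqP; rewrite mulrC eq_sym -subr_eq0 -[X in X - _]mulr1; apply/eqP.
    by have := Nd _ _ _ _ Hs' Hs; rewrite [s' * s]mulrC.
  + apply: yE; apply/eqP; rewrite eq_sym -subr_eq0 -[X in X - _]mulr1; apply/eqP.
    exact: Nd Hs Hs'.
  + suff -> : s = s' by [].
    apply/esym/eqP; rewrite -subr_eq0; apply/eqP; have := Nd _ _ _ _ Hs Hs'; by rewrite mulr1 mul1r.
have [NS _ Nu] := svalP N; apply: unit_ideal_sub Nu => a [d Hd].
have [[w w1] _ _] := locP a.
suff [b Hb] : exists b, swp b (sval N) a d.
  exists (fmap X (peval (khom_comp (loc a) u) (w * loc a d)) (y b)), b, (w * loc a d).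
  split=> //; rewrite -w1 -swp_span.
  have [_ S1] := span_im_submod (loc a) (swp b (sval N)).
  have [S0 _] := span_im_submod (loc a) (swp b (sval N)).
  by have := S1 w _ _ _ _ (span_im_gen (phi := loc a) Hb) S0; rewrite !addr0.
by case: Hd => Hd; [exists false|exists true].
Qed.

Lemma P1_glue : exists h : nat_trans (P1_over (Spec A)) X,
  forall (R : kalg k) (N : P1_fun k R) (u : khom A R) b s, swp b (sval N) 1 s ->
    @ntrans k _ _ h R (N, u) = fmap X (peval u s) (y b).
Proof.
pose h (R : kalg k) (z : P1_over (Spec A) R) : X R := sval (cid (P1_glue_ex z.1 z.2)).
have Hh R z := svalP (cid (@P1_glue_ex R z.1 z.2)).
have hn (R S : kalg k) (f : khom R S) z : h S (fmap (P1_over (Spec A)) f z) = fmap X f (h R z).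
  case: (Hh S (fmap (P1_over (Spec A)) f z)) => _; apply => S' phi _ [b [s [Hs ->]]].
  rewrite -fmap_comp; have [Hz _] := Hh R z; apply: Hz.
  exists b, s; split; first by rewrite [span_im _ _](span_im_comp f phi).
  congr (fmap X (peval _ _) _); exact: khom_ext.
exists (NatTrans hn) => R N u b s Hs /=.
have [Hz _] := Hh R (N, u).
rewrite -[LHS]fmap_id; apply: Hz; exists b, s; split.
  by rewrite span_im_id //; case: (svalP N).
congr (fmap X (peval _ _) _); exact: khom_ext.
Qed.

End Glue.
End PolyEval.

(** * Points of the projective line in its two charts *)

Section Points.
Variable k : fieldType.

Definition chart_pt (R : kalg k) (b : bool) (s : R) : P1_fun k R :=
  exist _ (swp b (graph s)) (swp_line b (graph_line s)).

Lemma chart_pt_map (R S : kalg k) (phi : khom R S) b (s : R) :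
  fmap (P1_fun k) phi (chart_pt b s) = chart_pt b (phi s).
Proof. by apply: (@sval_inj _ (@is_line S)); rewrite /= swp_span span_graph. Qed.

Lemma chart_pt_inv (R : kalg k) b (s s' : R) : s * s' = 1 -> chart_pt b s = chart_pt (~~ b) s'.
Proof.
move=> E; suff H (t t' : R) : t * t' = 1 -> chart_pt false t = chart_pt true t'.
  by case: b; [apply/esym/H; rewrite mulrC|apply: H].
move=> Et; apply: (@sval_inj _ (@is_line R)) => /=.
apply/funext => x; apply/funext => z; apply/propext; rewrite /swp /graph; split=> ->.
  by rewrite -mulrA Et mulr1.
by rewrite -mulrA (mulrC t') Et mulr1.
Qed.

End Points.

Lemma chart_ptP (K : fieldType) (N : P1_fun K (base_alg K)) :
  exists b (t : base_alg K), N = chart_pt b t.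
Proof.
have [b [t Ht]] := field_line (svalP N); exists b, t.
apply: (@sval_inj _ (@is_line K)) => /=.
by rewrite -[sval N in LHS](swpK b); congr (swp b _); apply: lineE Ht; apply/swp_line/svalP.
Qed.

Definition yon (k : fieldType) (X : kfunctor k) (C : kalg k) (x : X C) : nat_trans (Spec_fun C) X :=
  @NatTrans k (Spec_fun C) X (fun R phi => fmap X phi x)
    (fun R S f phi => fmap_comp f phi x).

Lemma nat_trans_eq (k : fieldType) (X Y : kfunctor k) (f g : nat_trans X Y) :
  (forall R x, f R x = g R x) -> f = g.
Proof.
case: f g => [f Hf] [g Hg] /= E.
have Efg : f = g by apply: functional_extensionality_dep => R; apply/funext => x.
by subst g; congr NatTrans; apply: Prop_irrelevance.
Qed.

Definition good_alg (k : fieldType) (C : kalg k) : Prop :=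
  [/\ variety (Spec C), integral (Spec C) & smooth (Spec C)].

(** * The presheaf [F] and elementary links *)

Section Presheaf.
Variables (k : fieldType) (F : scheme_presheaf k).
Hypothesis hF : forall U : scheme k, variety U -> integral U -> smooth U ->
  bijective (psh_map F (P1_proj U)).

Definition psh_equiv (X : scheme k) (C : kalg k) (x y : X C) : Prop :=
  forall b : F X, psh_map F (yon x : nat_trans (Spec C) X) b = psh_map F (yon y : nat_trans (Spec C) X) b.

(** Here the hypothesis on [F] enters: the class of [b] on [P^1_U] is pulled back from a class on
    [U], and pulling it back along any section returns that class. *)
Lemma sections_equal (U X : scheme k) (h : nat_trans (P1_over U) X) (s t : nat_trans U (P1_over U)) b :
  variety U -> integral U -> smooth U ->
  nt_comp (P1_proj U) s = nt_id U -> nt_comp (P1_proj U) t = nt_id U ->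
  psh_map F (nt_comp h s : nat_trans U X) b = psh_map F (nt_comp h t : nat_trans U X) b.
Proof.
move=> vU iU sU Es Et; rewrite !psh_comp.
have [g _ gK] := hF vU iU sU; rewrite -[psh_map F h b]gK.
rewrite -!psh_comp.
have -> : (nt_comp (P1_proj U) s : nat_trans U U) = (nt_id U : nat_trans U U) by exact: Es.
by have -> : (nt_comp (P1_proj U) t : nat_trans U U) = (nt_id U : nat_trans U U) by exact: Et.
Qed.

Variable X : scheme k.
Hypothesis Xproper : is_proper X.

Section Link.
Variables (K : fieldType) (j : {rmorphism k -> K}).
Variables (T : fieldType) (jT : {rmorphism K -> T}) (beta : khom (polyK K) (field_alg jT)).
Hypothesis betaL : loc_at (fun a => a <> 0) beta.

Let tT : field_alg jT := beta 'X.

Lemma tT_neq0 : tT <> 0.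
Proof.
move=> E; have := polyX_eq0 K; rewrite -(inj_eq (beta_inj betaL)).
by rewrite rmorph0 [beta _]E eqxx.
Qed.

(** The substitution of [1/t] for [t], which relates the two charts at the generic point. It extends
    from [K[t]] to [K(t)] because a nonzero polynomial does not vanish at [1/t]. *)
Lemma swap_ex : exists s : khom (field_alg jT) (field_alg jT), s tT * tT = 1.
Proof.
pose v : field_alg jT := (tT : T)^-1.
have vt : v * tT = 1 by apply: mulVf; apply/eqP/tT_neq0.
have [||s Es] := loc_at_lift betaL (phi := peval (str_hom (field_alg jT)) v).
- by move=> a b a0 b0 /eqP; rewrite mulf_eq0 => /orP[]/eqP.
- move=> p /eqP p0.
  suff E : peval (str_hom (field_alg jT)) v p != 0.
    by exists ((peval (str_hom (field_alg jT)) v p : T)^-1); apply: mulVf.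
  (* [q] is the reciprocal polynomial of [p]. *)
  pose n := (size p).-1; pose q : {poly K} := \poly_(i < n.+1) p`_(n - i).
  (* The constant coefficient of [q] is the leading coefficient of [p]. *)
  have : beta q != 0.
    rewrite -[X in _ != X](rmorph0 beta) (inj_eq (beta_inj betaL)).
    apply/eqP => /(congr1 (fun r : {poly K} => r`_0)); rewrite coef_poly coef0 /= subn0.
    by apply/eqP; rewrite -lead_coefE lead_coef_eq0.
  apply: contra_neq => E0.
  suff -> : beta q = tT ^+ n * peval (str_hom (field_alg jT)) v p by rewrite E0; exact: mulr0.
  have sp : size p = n.+1 by rewrite prednK // size_poly_gt0.
  rewrite [in RHS](_ : p = \poly_(i < n.+1) p`_i); last by rewrite -sp coefK.
  rewrite /q !poly_def !rmorph_sum mulr_sumr.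
  rewrite [LHS](reindex_inj rev_ord_inj) /=; apply: eq_bigr => i _.
  rewrite subSS subKn; last by rewrite -ltnS.
  rewrite -!mul_polyC !rmorphM !rmorphXn pevalC pevalX.
  have -> : beta (p`_i)%:P = str_hom (field_alg jT) p`_i by apply: (khomP beta).
  have ni : (i <= n)%N by rewrite -ltnS.
  have -> : tT ^+ n = tT ^+ (n - i) * tT ^+ i by rewrite -exprD subnK.
  rewrite -/tT [RHS]mulrCA -mulrA (mulrC (tT ^+ i)) (exp_unit i vt) mulr1; congr (_ * _).
exists s; suff -> : s tT = v by [].
have -> : s tT = peval (str_hom (field_alg jT)) v 'X by rewrite -Es.
exact: pevalX.
Qed.

(** The generic values of [h] in the two charts extend to affine lines over a large model by
    [extension]. The extensions glue to a map from the projective line over the model, and [y], [y']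
    are its restrictions to two sections, so [sections_equal] applies. *)
Lemma link_spread (x x' : base_change j X (base_alg K)) : R_linked x x' ->
  large (fun M : model j => good_alg (malg M) -> forall y y' : X (malg M),
    fmap X (mmap M) y = x -> fmap X (mmap M) y' = x' -> psh_equiv y y').
Proof.
case=> [W [h [a [a' [Ea Ea']]]]].
have [sepX fX uX] := Xproper; have [sX _] := schemeP X.
(* The graph of [h] as a relation, which hides the proofs of membership in [W]. *)
pose G (R : kalg K) (p : P1_fun K R) (z : X (restr_alg j R)) :=
  exists Wp : open_mem W p, z = h R (exist _ p Wp).
have Gn (R S : kalg K) (phi : khom R S) p z : G R p z -> G S (fmap _ phi p) (fmap X (restr_hom j phi) z).
  move=> [Wp ->]; exists (open_stable phi Wp).
  rewrite -[LHS](ntransP h phi (exist _ p Wp)); congr (h S _).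
  exact: eq_exist.
have Gf (R : kalg K) p z z' : G R p z -> G R p z' -> z = z'.
  by move=> [Wp ->] [Wp' ->]; congr (h R _); apply: eq_exist.
have Ga : G _ (sval a) x by exists (svalP a); rewrite -Ea; congr (ntrans h _); apply: sval_inj.
have Ga' : G _ (sval a') x' by exists (svalP a'); rewrite -Ea'; congr (ntrans h _); apply: sval_inj.
have [s Es] := swap_ex.
have Es' : tT * s tT = 1 by rewrite mulrC.
(* A point of [W] in chart [c] has a basic neighbourhood [D(g)] of the line contained in [W]. *)
have near (c : bool) (t : base_alg K) z : G _ (chart_pt c t) z ->
    exists g : polyK K, peval (khom_id (base_alg K)) t g <> 0 /\ exists w, G _ (chart_pt c (loc g 'X)) w.
  move=> [Wt _].
  have [E HE] := open_memP W (chart_pt c ('X : polyK K)).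
  have Ept : chart_pt c t = fmap (P1_fun K) (peval (khom_id (base_alg K)) t) (chart_pt c ('X : polyK K)).
    by rewrite chart_pt_map pevalX.
  move: Wt; rewrite Ept => /HE/field_unit_ideal [_ [g Eg ->] /eqP g0]; exists g; split=> //.
  suff Wg : open_mem W (chart_pt c (loc g 'X)) by exists (h (Loc g) (exist _ (chart_pt c (loc g 'X)) Wg)); exists Wg.
  rewrite -chart_pt_map; apply/HE => I II HI.
  have [[w <-] _ _] := locP g; apply: ideal_mul => //; apply: HI; by exists g.
have [ca [ta Ept]] := chart_ptP (sval a); have [ca' [ta' Ept']] := chart_ptP (sval a').
rewrite Ept in Ga; rewrite Ept' in Ga'.
(* Being nonempty, [W] contains the generic point in the chart of [a]; in the other chart the point
   with coordinate [t] is its image under [s]. *)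
have gen (c : bool) : exists z, G (field_alg jT) (chart_pt c tT) z.
  have {}gen : exists z, G (field_alg jT) (chart_pt ca tT) z.
    have [g [g0 [w Gw]]] := near _ _ _ Ga.
    have gn0 : g <> 0 by move=> E; apply: g0; rewrite E rmorph0.
    have [th Eth _] := loc_field_inj (locP g) (beta_inj betaL) gn0.
    exists (fmap X (restr_hom j th) w); have := Gn _ _ th _ _ Gw.
    rewrite chart_pt_map; suff -> : th (loc g 'X) = tT by [].
    by rewrite /tT -Eth.
  have [->//|nc] := eqVneq c ca.
  have -> : c = ~~ ca by case: (c) (ca) nc => -[].
  have [z Gz] := gen; exists (fmap X (restr_hom j s) z).
  by rewrite -(@chart_pt_inv _ _ ca (s tT) tT) // -chart_pt_map; apply: Gn.
pose gam c := sval (cid (gen c)).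
have Ggam c : G _ (chart_pt c tT) (gam c) := svalP (cid (gen c)).
have Hext c := extension betaL uX fX sepX sX (gam c).
apply: large_imp (large_and (large_and (Hext false) (Hext true)) (large_and (large_elt j ta) (large_elt j ta'))).
move=> M [[[y0 Ey0] [y1 Ey1]] [[b Eb] [b' Eb']]] [vM iM smM] y y' Ey Ey'.
pose yy c := if c then y1 else y0.
have Eyy c : fmap X (mrat beta M) (yy c) = gam c by case: c.
have sgam : fmap X (restr_hom j s) (gam true) = gam false.
  apply: (Gf _ (chart_pt false tT)); last exact: Ggam.
  by rewrite -(@chart_pt_inv _ _ true (s tT) tT) // -chart_pt_map; apply: Gn.
have bC (r : K) : beta r%:P = kalg_str (field_alg jT) r := khomP beta r.
have mC (d : mring M) : mrat beta M d%:P = kalg_str (field_alg jT) (mmap M d).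
  by rewrite -bC /= map_polyC.
have mX : mrat beta M 'X = tT by rewrite /= map_polyX.
(* It suffices to treat the universal invertible coordinate, over the model with [t] and [1/t]
   adjoined. This ring embeds in [K(t)], where the equality is [sgam]. *)
have compat (R : kalg k) (u : khom (malg M) R) r r' : r * r' = 1 ->
    fmap X (peval u r) (yy false) = fmap X (peval u r') (yy true).
  move=> Er.
  have X0 : ('X : mpoly M) <> 0 by apply/eqP; rewrite polyX_eq0.
  have [th Eth thinj] := loc_field_inj (locP ('X : mpoly M)) (@mrat_inj _ _ j _ _ _ betaL M) X0.
  have [[w Ew] _ _] := locP ('X : mpoly M).
  pose tau := peval (khom_comp (loc ('X : mpoly M)) (const_hom (mstr M))) w.
  have E1 : fmap X (loc ('X : mpoly M)) (yy false) = fmap X tau (yy true).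
    apply: (separated_inj sepX thinj); rewrite -!fmap_comp Eth.
    have thE p : th (loc ('X : mpoly M) p) = mrat beta M p by rewrite -Eth.
    have -> : khom_comp th tau = khom_comp (restr_hom j s) (mrat beta M).
      apply: poly_hom_eq.
        apply: khom_ext => d; rewrite /= pevalC.
        change (th (loc ('X : mpoly M) d%:P) = s (mrat beta M d%:P)).
        by rewrite thE mC; apply/esym/(khomP s).
      change (th (tau 'X) = s (mrat beta M 'X)); rewrite pevalX mX.
      have Ew' : th w * tT = 1.
        by rewrite -[RHS](rmorph1 th) -Ew rmorphM thE mX.
      by rewrite -[RHS]mul1r -Ew' -mulrA Es' mulr1.
    by rewrite [RHS]fmap_comp !Eyy sgam.
  have [|ze Eze] := localization_lift (locP ('X : mpoly M)) (phi := peval u r).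
    by exists r'; rewrite pevalX mulrC.
  have -> : peval u r' = khom_comp ze tau.
    rewrite peval_comp; congr peval.
      by apply: khom_ext => c /=; rewrite -[in LHS](pevalC u r) -Eze.
    have Er2 : ze w * r = 1.
      by rewrite -[r](pevalX u) -Eze /= -rmorphM Ew rmorph1.
    by rewrite -[LHS]mul1r -Er2 -mulrA Er mulr1.
  by rewrite fmap_comp -E1 -fmap_comp Eze.
(* By separatedness [v] is determined over [K]. On [D(g)] the map [h] and the extension agree, since
   they agree at the generic point; specializing to the coordinate [t] gives the claim. *)
have value (c : bool) (t : base_alg K) (d : malg M) z (v : X (malg M)) : mmap M d = t ->
    G _ (chart_pt c t) z -> fmap X (mmap M) v = z -> v = fmap X (peval (khom_id (malg M)) d) (yy c).
  move=> Ed Gz Ev; apply: (separated_inj sepX (@minj _ _ _ M)); rewrite Ev -fmap_comp peval_comp.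
  have [g [g0 [w Gw]]] := near _ _ _ Gz.
  have gn0 : g <> 0 by move=> E; apply: g0; rewrite E rmorph0.
  have [th Eth thinj] := loc_field_inj (locP g) (beta_inj betaL) gn0.
  have Ew : w = fmap X (khom_comp (restr_hom j (loc g)) (mpoly_map M)) (yy c).
    apply: (@separated_inj _ _ _ _ (restr_hom j th) _ _ sepX thinj); rewrite -fmap_comp.
    have -> : khom_comp (restr_hom j th) (khom_comp (restr_hom j (loc g)) (mpoly_map M)) = mrat beta M.
      by apply: khom_ext => p /=; rewrite -Eth.
    rewrite Eyy; apply: (Gf _ (chart_pt c tT)); last exact: Ggam.
    have := Gn _ _ th _ _ Gw; rewrite chart_pt_map.
    by have -> : th (loc g 'X) = tT by rewrite /tT -Eth.
  have [|e Ee] := localization_lift (locP g) (phi := peval (khom_id (base_alg K)) t).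
    by exists ((peval (khom_id (base_alg K)) t g : K)^-1); apply: mulVf; apply/eqP.
  have eE p : e (loc g p) = peval (khom_id (base_alg K)) t p by rewrite -Ee.
  have -> : z = fmap X (restr_hom j e) w.
    apply: (Gf _ (chart_pt c t)) => //; have := Gn _ _ e _ _ Gw.
    by rewrite chart_pt_map eE pevalX.
  rewrite Ew -fmap_comp; congr (fmap X _ _); apply: poly_hom_eq.
    apply: khom_ext => r; rewrite /= pevalC map_polyC.
    by rewrite [LHS]eE pevalC.
  by rewrite pevalX /= map_polyX [LHS]eE pevalX.
have [hh Hhh] := P1_glue sX compat.
have secn (c : bool) (d : malg M) (R S : kalg k) (f : khom R S) (u : Spec (malg M) R) :
    (chart_pt c (fmap (Spec (malg M)) f u d), fmap (Spec (malg M)) f u)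
    = fmap (P1_over (Spec (malg M))) f (chart_pt c (u d), u).
  by congr (_, _); rewrite chart_pt_map.
pose sec c d : nat_trans (Spec (malg M)) (P1_over (Spec (malg M))) :=
  @NatTrans k (Spec (malg M)) (P1_over (Spec (malg M)))
    (fun R u => (chart_pt c (u d), u)) (secn c d).
have Esec c d : (yon (fmap X (peval (khom_id (malg M)) d) (yy c)) : nat_trans (Spec (malg M)) X)
    = nt_comp hh (sec c d).
  apply: nat_trans_eq => R u /=.
  rewrite (Hhh _ (chart_pt c (u d)) u c (u d)) /= ?swpK /graph ?mul1r //.
  rewrite -fmap_comp peval_comp; congr (fmap X (peval _ _) _); exact: khom_ext.
move=> z0; rewrite (value _ _ _ _ _ Eb Ga Ey) (value _ _ _ _ _ Eb' Ga' Ey') !Esec.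
by apply: sections_equal => //; apply: nat_trans_eq.
Qed.

End Link.
End Presheaf.

(** * Affine opens *)

Section SpecFacts.
Variables (k : fieldType) (C : kalg k).

Lemma spec_represents : represents (open_setT (Spec C)) (khom_id C : Spec C C).
Proof.
split=> // R x _; exists x; split; first exact: khom_ext.
by move=> z <-; apply: khom_ext.
Qed.

Lemma spec_variety : fin_gen C -> variety (Spec C).
Proof.
move=> fC; split; last first.
  exists 1%N, (fun=> open_setT _), (fun=> C), (fun=> khom_id C); split=> [i|K j x].
    by split=> //; apply: spec_represents.
  by exists ord0.
move=> R x y; exists (fun a => exists c, a = x c - y c) => S phi; split=> [E _ [c ->]|H].
  have := congr1 (fun h : khom C S => h c) E; rewrite /= rmorphB => ->.
  by rewrite subrr.
apply: khom_ext => c; apply/eqP; rewrite -subr_eq0 /= -rmorphB; apply/eqP/H.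
by exists c.
Qed.

Lemma spec_locally_finite_type : fin_gen C -> locally_finite_type (Spec C).
Proof.
move=> fC K j x; exists (open_setT _), C, (khom_id C); split=> //.
exact: spec_represents.
Qed.

Lemma fraction_inj (F : fieldType) (j : {rmorphism k -> F}) (iota : khom C (field_alg j)) :
  (forall b c : C, b * c = 0 -> b = 0 \/ c = 0) ->
  loc_at (fun a => a <> 0) iota -> injective iota.
Proof.
move=> dom [_ _ Lz] x y /eqP; rewrite -subr_eq0 -rmorphB => /eqP /Lz [d d0 /dom [//|/eqP]].
by rewrite subr_eq0 => /eqP.
Qed.

(** The ring of a nonempty affine open embeds in the fraction field of [C]: an element with zero
    image vanishes on each nonempty basic open [D(e)] of a cover, because [C[1/e]] embeds in that
    field as well. *)
Lemma spec_integral : (1 : C) <> 0 -> (forall b c : C, b * c = 0 -> b = 0 \/ c = 0) ->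
  integral (Spec C).
Proof.
move=> C1 dom; have [F [jF [iota L]]] := fraction_field C1 dom.
have inj := fraction_inj dom L.
split; first by exists F, jF; split; exact: iota.
move=> V A a rV A1; have [E HE] := open_memP V (khom_id C : Spec C C).
have VE (R : kalg k) (phi : khom C R) : open_mem V (phi : Spec C R) <-> unit_ideal (im_set phi E).
  by rewrite -HE; have -> : fmap (Spec C) phi (khom_id C) = phi by apply: khom_ext.
have uA : unit_ideal (im_set a E) by apply/VE; case: rV.
have [e0 Ee0 e00] : exists2 e, E e & e <> 0.
  apply: contrapT => H; apply: A1; apply: (uA (fun c => c = 0)).
    by split=> // c x y -> ->; rewrite mulr0 addr0.
  move=> _ [e Ee ->]; have [->|e0] := pselect (e = 0); first by rewrite rmorph0.
  by case: H; exists e.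
have Vi : open_mem V (iota : Spec C (field_alg jF)).
  apply/VE/field_unit_ideal; exists (iota e0); first by exists e0.
  by apply/eqP => E0; apply: e00; apply: inj; rewrite E0 rmorph0.
have [i' [Ei' Ui']] := rV.2 _ _ Vi.
have i'0 b : i' b = 0 -> b = 0.
  move=> ib; rewrite -[b]mul1r.
  apply: (unit_ideal_exp (I := fun c => c * b = 0) uA).
    split=> [|c x y Ex Ey]; first by rewrite mul0r.
    by rewrite mulrDl -mulrA Ex Ey mulr0 addr0.
  move=> _ [e Ee ->]; have [->|en0] := pselect (e = 0).
    by exists 1%N; rewrite rmorph0 mul0r.
  have Vl : open_mem V (loc e : Spec C (Loc e)).
    apply/VE => I II HI; have [[w <-] _ _] := locP e.
    by apply: ideal_mul => //; apply: HI; exists e.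
  have [q [Eq Uq]] := rV.2 _ _ Vl.
  have [th Eth thinj] := loc_field_inj (locP e) inj en0.
  have Eqi : i' = khom_comp th q.
    by apply: Ui'; rewrite -[RHS]Eth -Eq; apply: khom_ext.
  have qb : q b = 0 by apply: thinj; rewrite rmorph0 -[RHS]ib Eqi.
  have [|m Em] := localization_lift (locP e) (phi := khom_comp (loc (a e)) a).
    by case: (locP (a e)).
  have Vla : open_mem V (khom_comp (loc (a e)) a : Spec C _) by apply: (open_stable (loc (a e)) rV.1).
  have [r [_ Ur]] := rV.2 _ _ Vla.
  have Emq : khom_comp m q = loc (a e).
    rewrite -(Ur (loc (a e)) erefl); apply/esym/Ur; rewrite -Em -Eq; exact: khom_ext.
  by have [_ _] := locP (a e); apply; rewrite -Emq /= qb rmorph0.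
move=> b c bc; have /eqP : (i' b : F) * i' c = 0 by rewrite -(rmorph0 i') -bc rmorphM.
by rewrite mulf_eq0 => /orP[/eqP /i'0|/eqP /i'0]; [left|right].
Qed.

End SpecFacts.

(** A square-zero thickening has the same open subsets: if [b] in the ideal lifts 1, then
    [(1 - b)^2 = 0], so [b] has inverse [2 - b]. *)
Lemma open_infinitesimal (k : fieldType) (X : kfunctor k) (O : open_sub X) (B C : kalg k) (phi : khom B C) (x : X B) :
  (forall c, exists b, phi b = c) -> (forall a b, phi a = 0 -> phi b = 0 -> a * b = 0) ->
  open_mem O (fmap X phi x) -> open_mem O x.
Proof.
move=> surj sq; have [E HE] := open_memP O x.
move=> /HE uE; apply/(open_spec_id HE) => I II HI; have [I0 I1] := II.
have [||b [Ib b1]] := uE (fun c => exists b, I b /\ phi b = c).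
- split=> [|c _ _ [b [Ib <-]] [b' [Ib' <-]]]; first by exists 0; rewrite rmorph0.
  have [d <-] := surj c; exists (d * b + b'); rewrite rmorphD rmorphM.
  by split=> //; apply: I1.
- by move=> _ [b Eb ->]; exists b; split=> //; apply: HI.
have E0 : phi (1 - b) = 0 by rewrite rmorphB rmorph1 b1 subrr.
have := sq _ _ E0 E0 => E1.
have -> : 1 = (2 - b) * b + 0 by rewrite -E1; ring.
exact: I1.
Qed.

(** * Localized charts as smooth affine opens *)

Section Chart.
Variables (k : fieldType) (X : kfunctor k) (V : open_sub X) (A : kalg k) (a : X A).
Hypothesis rV : represents V a.
Variables (f : A) (C : kalg k) (lam : khom A C).
Hypothesis L : is_localization f lam.

Lemma represents_eq (R : kalg k) (phi psi : khom A R) : fmap X phi a = fmap X psi a -> phi = psi.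
Proof.
move=> E; have [chi [_ U]] := rV.2 _ _ (open_stable psi rV.1).
by rewrite -(U _ E) -(U psi).
Qed.

(** The image is the nonvanishing locus of the function [f] on [V], open by [basic_open]. *)
Lemma loc_open_immersion : open_immersion (yon (fmap X lam a)).
Proof.
have [|||O HO] := @basic_open k X V (fun R x g => exists2 chi : khom A R, fmap X chi a = x & g = chi f).
- by move=> R x /rV.2 [chi [E _]]; exists (chi f), chi.
- by move=> R x _ _ [chi E ->] [chi' E' ->]; congr (khom_fun _ _); apply: represents_eq; rewrite E.
- by move=> R S phi x _ [chi <- ->]; exists (khom_comp phi chi); rewrite ?fmap_comp.
exists O; split=> [R u v /=|R x].
  by rewrite -!fmap_comp => /represents_eq /(localization_eq L).
split=> [/HO [Vx [_ [w [[chi <- ->] Ew]]]]|[u <-] /=].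
  have [|u Eu] := localization_lift L (phi := chi); first by exists w.
  by exists u; rewrite /= -fmap_comp Eu.
have [[w Ew] _ _] := L.
rewrite -fmap_comp; apply/HO; split; first by apply: open_stable rV.1.
exists (u (lam f)), (u w); split; first by exists (khom_comp u lam).
by rewrite -rmorphM Ew rmorph1.
Qed.

Lemma loc_fin_gen : fin_gen A -> fin_gen C.
Proof.
move=> [s gs]; have [[w Ew] Ls _] := L; exists (w :: [seq lam b | b <- s]) => P Pc PD PM Ps.
have Pl b : P (lam b).
  apply: (gs (fun b => P (lam b))) => [c|b1 b2 ? ?|b1 b2 ? ?|b1 b1s].
  - by rewrite khomP.
  - by rewrite rmorphD; apply: PD.
  - by rewrite rmorphM; apply: PM.
  - by apply: Ps; rewrite inE map_f ?orbT.
have Pw n : P (w ^+ n).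
  elim: n => [|n IH]; first by rewrite expr0 -(rmorph1 lam).
  by rewrite exprS; apply: PM => //; apply: Ps; rewrite mem_head.
move=> c; have [r [n E]] := Ls c.
have -> : c = lam r * w ^+ n by rewrite -E -mulrA (mulrC _ (w ^+ n)) (exp_unit n Ew) mulr1.
exact: PM.
Qed.

(** An infinitesimal lift exists in the smooth scheme [U]; by [open_infinitesimal] its image in [X]
    stays inside the open subset [Spec C]. *)
Lemma loc_smooth (U : kfunctor k) (i : nat_trans U X) (W : open_sub X) :
  open_immersion_onto i W -> smooth U -> open_mem W (fmap X lam a) -> fin_gen A -> smooth (Spec C).
Proof.
move=> [iinj iW] [_ sU] Wa fA; split; first exact: spec_locally_finite_type (loc_fin_gen fA).
have [O [yinj yO]] := loc_open_immersion.
move=> B D phi surj sq y; pose x := fmap X y (fmap X lam a).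
have /iW [u Eu] : open_mem W x by apply: open_stable.
have [u' Eu'] := sU _ _ phi surj sq u.
have Ex : fmap X phi (i B u') = x by rewrite -ntransP Eu'.
have /yO [z Ez] : open_mem O (i B u').
  by apply: (open_infinitesimal surj sq); rewrite Ex; apply/yO; exists y.
exists z; apply: yinj; change (fmap X (khom_comp phi z) (fmap X lam a) = x).
by rewrite fmap_comp -Ex -Ez.
Qed.

End Chart.

(** * Chains of links over a common model *)

Section Chain.
Variables (k : fieldType) (F : scheme_presheaf k).
Hypothesis hF : forall U : scheme k, variety U -> integral U -> smooth U ->
  bijective (psh_map F (P1_proj U)).
Variable X : scheme k.
Hypothesis Xproper : is_proper X.
Variables (K : fieldType) (j : {rmorphism k -> K}).

Lemma point_spread (x : X (scal j)) : large (fun M : model j => exists y : X (malg M), fmap X (mmap M) y = x).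
Proof.
have [_ [n [V [A [a [Ha cX]]]]] _] := Xproper.
have [i Vx] := cX K (idfun \o j : {rmorphism k -> K}) x.
have [rV [s gs]] := Ha i; have [psi [Epsi _]] := rV.2 _ _ Vx.
have := large_seq (r := s) (fun c _ => large_elt j (psi c)).
apply: large_imp => M HM; have [psi' E] := generates_lift gs (@minj _ _ _ M) HM.
by exists (fmap X psi' (a i)); rewrite -fmap_comp E.
Qed.

(** By induction on the chain, with [point_spread] providing the intermediate points over a large
    model. In the reflexive case, two points over the model with the same value over [K] are equal
    by separatedness. *)
Lemma R_equiv_spread (x x' : base_change j X (base_alg K)) : R_equiv x x' ->
  large (fun M : model j => good_alg (malg M) -> forall y y' : X (malg M),
    fmap X (mmap M) y = x -> fmap X (mmap M) y' = x' -> psh_equiv F y y').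
Proof.
have polyK1 : (1 : polyK K) <> 0 by apply/eqP; exact: oner_neq0.
have polyKd (b c : polyK K) : b * c = 0 -> b = 0 \/ c = 0.
  by move=> /eqP; rewrite mulf_eq0 => /orP[]/eqP; [left|right].
have [T [jT [beta betaL]]] := fraction_field polyK1 polyKd.
elim=> {x x'} [x x'|x|x z x' _ IH1 _ IH2].
- exact: (link_spread hF Xproper betaL).
- exists [::] => M _ _ y y' Ey Ey'; suff -> : y = y' by [].
  have [sepX _ _] := Xproper; apply: (separated_inj sepX (@minj _ _ _ M)).
  by rewrite Ey Ey'.
- apply: large_imp (large_and (large_and IH1 IH2) (point_spread z)) => M [[H1 H2] [w Ew]] gM y y' Ey Ey' b.
  by rewrite (H1 gM y w) // (H2 gM w y').
Qed.

End Chain.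

(** * Models with prescribed elements, and the conclusion *)

Lemma localization_iso (k : fieldType) (R S S' : kalg k) (f : R) (rho : khom R S)
    (u : khom S S') (v : khom S' S) :
  is_localization f rho -> cancel u v -> cancel v u -> is_localization f (khom_comp u rho).
Proof.
move=> [[w Ew] Ls Lz] uK vK; split.
- by exists (u w); rewrite /= -rmorphM Ew rmorph1.
- move=> s; have [r [n E]] := Ls (v s); exists r, n.
  by rewrite /= -rmorphXn -[s]vK -rmorphM E.
- by move=> r /= /(congr1 v); rewrite uK rmorph0; apply: Lz.
Qed.

(** Take [f = e * d], where [d] is a common denominator of the elements of [s]. This is how the
    finite set hidden in a [large] property is met. *)
Lemma generic_model (k : fieldType) (A : kalg k) (K : fieldType) (j : {rmorphism k -> K})
    (iota : khom A (scal j)) (e : A) (s : seq K) :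
  (forall b c : A, b * c = 0 -> b = 0 \/ c = 0) ->
  loc_at (fun a => a <> 0) iota -> injective iota -> e <> 0 ->
  exists (f : A) (M : model j) (lam : khom A (malg M)),
    [/\ is_localization f lam, khom_comp (mmap M) lam = iota,
        exists u, u * lam e = 1 & forall x, x \in s -> exists b, mmap M b = x].
Proof.
move=> dom [_ Ls _] inj e0.
have [d [d0 Hd]] : exists d, d <> 0 /\ forall x, x \in s -> exists r, (x : scal j) * iota d = iota r.
  elim: s => [|x s [d [d0 Hd]]]; first by exists e.
  have [r [c [c0 E]]] := Ls x; exists (c * d); split; first by move=> /dom [].
  move=> x'; rewrite inE => /orP[/eqP ->|/Hd [r' E']].
    by exists (r * d); rewrite !rmorphM mulrA E.
  by exists (c * r'); rewrite !rmorphM mulrCA E'.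
pose f := e * d; have f0 : f <> 0 by move=> /dom [].
have [th Eth thinj] := @loc_field_inj k A _ K (idfun \o j : {rmorphism k -> K}) iota f _ (locP f) inj f0.
have L1 : (1 : Loc f) <> 0.
  move=> E; have /eqP := oner_neq0 K; apply.
  by rewrite -[LHS](rmorph1 th) E; apply: rmorph0.
(* A model requires a ring known by its type to be nonzero, so [Loc f] is replaced by an isomorphic
   copy. *)
have [B [jB [u [v [uK vK]]]]] := nz_kalg L1.
have minj : injective (khom_comp th v : khom _ (scal j)).
  by move=> x y /thinj /(can_inj vK).
pose M := Model minj.
exists f, M, (khom_comp u (loc f)).
have Em : khom_comp (mmap M) (khom_comp u (loc f)) = iota.
  by apply: khom_ext => a; rewrite /= uK -[in RHS]Eth.
have [[w Ew] _ _] := locP f; split=> //.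
- exact: localization_iso (locP f) uK vK.
- by exists (u (w * loc f d)); rewrite /= -rmorphM -mulrA (mulrC (loc f d)) -rmorphM Ew rmorph1.
move=> x /Hd [r E]; exists (u (w * loc f (e * r))); rewrite /= uK.
have thE b : th (loc f b) = iota b by rewrite -Eth.
rewrite rmorphM thE rmorphM -E.
have Ew' : th w * (iota e * iota d) = 1 by rewrite -rmorphM -thE -rmorphM Ew rmorph1.
transitivity ((x : scal j) * (th w * (iota e * iota d))); last by rewrite [X in _ * X]Ew'; exact: mulr1.
by rewrite (mulrCA (iota e)) [LHS]mulrCA.
Qed.

Theorem proposition3p29 (k : fieldType) (F : scheme_presheaf k)
    (hF : forall U : scheme k, variety U -> integral U -> smooth U ->
            bijective (psh_map F (P1_proj U)))
    (X : scheme k)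
    (hXproper : is_proper X) (hXint : integral X) (hXsm : generically_smooth X)
    (hXR : almost_R_trivial X) :
  exists (U : scheme k) (i : nat_trans U X),
    [/\ open_immersion i, scheme_nonempty U, smooth U
      & forall a : F U,
          (exists b : F X, psh_map F i b = a) <->
          (exists c : F (Spec (base_alg k)), psh_map F (structure_map U) c = a)].
Proof.
have [sepX [n [Vs [As [as_ [Has cX]]]]] _] := hXproper.
have [[K0 [j0 [x00]]] domX] := hXint.
have [Us [is_ [Ws [imW dW sU]]]] := hXsm.
have [WR [dR HR]] := hXR.
(* Density is used twice, to find a point [x2] common to the R-trivial open [WR] and the smooth open
   [Ws]. *)
have [K1 [j1 [x1 [_ x1R]]]] : exists (K : fieldType) (j : {rmorphism k -> K}) (x : X (field_alg j)),
    open_mem (open_setT X) x /\ open_mem WR x by apply: dR; exists K0, j0, x00.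
have [K2 [j2 [x2 [x2R x2W]]]] : exists (K : fieldType) (j : {rmorphism k -> K}) (x : X (field_alg j)),
    open_mem WR x /\ open_mem Ws x by apply: dW; exists K1, j1, x1.
have [i Vx2] := cX _ _ x2; have [rV fA] := Has i.
move: (Vs i) (As i) (as_ i) rV fA Vx2 => V A a rV fA Vx2 {Vs As as_ Has cX i}.
have [xi [Exi _]] := rV.2 _ _ Vx2.
have A1 : (1 : A) <> 0.
  by move=> E; have /eqP := oner_neq0 K2; apply; rewrite -[LHS](rmorph1 xi) E; apply: rmorph0.
have dom := domX _ _ _ rV A1.
(* An open subset containing [x2] contains a nonempty basic open of the chart, hence also the
   generic point. *)
have point_nz (W : open_sub X) : open_mem W x2 ->
    exists e : A, e <> 0 /\ forall (R : kalg k) (phi : khom A R),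
      (exists u, u * phi e = 1) -> open_mem W (fmap X phi a).
  have [E HE] := open_memP W a; rewrite -Exi => /HE/field_unit_ideal [_ [e Ee ->] /eqP xe].
  exists e; split=> [e0|R phi [u Eu]]; first by apply: xe; rewrite e0; apply: rmorph0.
  by apply/HE => I II HI; rewrite -Eu; apply: ideal_mul => //; apply: HI; exists e.
have [eR [eR0 HeR]] := point_nz _ x2R; have [eW [eW0 HeW]] := point_nz _ x2W.
have [K [j [iota L]]] := fraction_field A1 dom.
have inj := fraction_inj dom L.
(* The two [k]-algebra structures on [K] differ by a composition with the identity map; [idK] passes
   between them. *)
pose idK : khom (field_alg j) (scal j) := @KHom k (field_alg j) (scal j) idfun (fun=> erefl).
pose iota' : khom A (scal j) := khom_comp idK iota.
pose eta : base_change j X (base_alg K) := fmap X iota' a.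
have Reta : @open_mem k X WR (scal j) eta.
  apply: HeR; exists ((iota eR : K)^-1); apply: mulVf; apply/eqP => E.
  by apply: eR0; apply: inj; rewrite E rmorph0.
(* Over [k] itself the R-trivial open has a rational point [P0]; over [K], both the generic point
   and the constant point given by [P0] are R-equivalent to [P]. *)
have [P0 [P0R _]] := HR k idfun; have [P [PR HP]] := HR K j.
pose idk : khom (restr_alg idfun (base_alg k)) (base_alg k) :=
  @KHom k (restr_alg idfun (base_alg k)) (base_alg k) idfun (fun=> erefl).
pose p0 : X (base_alg k) := fmap X idk P0.
have p0R : open_mem WR p0 := open_stable idk P0R.
have RP0 : R_equiv P (fmap X (str_hom (scal j)) p0) by apply: HP; apply: open_stable p0R.
(* One finite set of elements of [K] serves both chains and the point [P] where they meet. *)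
have [s Hs] := large_and (point_spread hXproper P)
  (large_and (R_equiv_spread hF hXproper (HP _ Reta)) (R_equiv_spread hF hXproper RP0)).
have [f [M [lam [Lf Elam [u Eu] Ms]]]] := @generic_model k A K j iota' eW s dom L inj eW0.
have [[y Ey] [Heta Hp0]] := Hs M Ms.
have iC : integral (Spec (malg M)).
  apply: spec_integral => [|b c]; first by apply/eqP; exact: oner_neq0.
  move/(congr1 (mmap M)); rewrite rmorphM rmorph0 => /eqP.
  rewrite (mulf_eq0 (_ : K)) => /orP[]/eqP E; [left|right]; apply: (@minj _ _ _ M).
    by rewrite E rmorph0.
  by rewrite E rmorph0.
have fC : fin_gen (malg M) := loc_fin_gen Lf fA.
have sC : smooth (Spec (malg M)).
  by apply: (loc_smooth rV Lf imW sU _ fA); apply: HeW; exists u.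
have gM : good_alg (malg M) by split=> //; apply: spec_variety.
have key : psh_equiv F (fmap X lam a) (fmap X (str_hom (malg M)) p0).
  move=> b; rewrite -(Heta gM y) //; last by rewrite -fmap_comp Elam.
  apply: (Hp0 gM y) => //; rewrite -fmap_comp; congr (fmap X _ _).
  by apply: khom_ext => c; apply: (khomP (mmap M)).
exists (Spec (malg M)), (yon (fmap X lam a)); split=> //.
- exact: (loc_open_immersion rV Lf).
- by case: iC.
move=> z; split=> [[b <-]|[c <-]].
  exists (psh_map F (yon p0 : nat_trans (Spec (base_alg k)) X) b).
  rewrite -psh_comp key; congr (psh_map F _ b).
  by apply: nat_trans_eq => R v /=; rewrite -fmap_comp; congr (fmap X _ _); apply: khom_ext => d; rewrite /= khomP.
(* A class coming from [F(k)] extends to [X], since the structure map of [U] factors through [X]. *)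
exists (psh_map F (structure_map X) c); rewrite -psh_comp; congr (psh_map F _ c).
exact: nat_trans_eq.
Qed.
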